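(* Let $\lambda=(a^b,c^d)$ be a fat hook, and let $U$ be any unique rectification target (for $\mathbb{N}^2$) that fits in the corner of $M_\lambda$. Then $M_\lambda\cup U$ is a unique rectification target (for $\mathbb{N}^2$).
   Context: **Type A.** Let $\Lambda=\mathbb{N}^2$ ($\mathbb{N}=\{1,2,3,\dots\}$), whose elements $[r,c]$ are boxes in row $r$ (rows numbered top to bottom) and column $c$ (columns numbered left to right), with partial order $[r_1,c_1]\le[r_2,c_2]$ iff $r_1\le r_2$ and $c_1\le c_2$. A straight shape is a finite lower order ideal of $\mathbb{N}^2$ (a Young diagram, identified with the partition of its row lengths); a skew shape is $\nu/\lambda:=\nu\setminus\lambda$ with $\lambda\subset\nu$ straight shapes. An increasing tableau is a map $T:\nu/\lambda\to\mathbb{Z}$ on a skew shape with $T(\alpha)<T(\beta)$ whenever $\alpha<\beta$. **Slides.** Two boxes are neighbors if one covers the other. For a tableau $Y$ with values in a set $S$ and $s,s'\in S$, $\mathrm{swap}_{s,s'}(Y)$ is the tableau of the same shape sending $\alpha$ to $s'$ if $Y(\alpha)=s$ and $Y(\beta)=s'$ for some neighbor $\beta$ of $\alpha$; to $s$ if $Y(\alpha)=s'$ and $Y(\beta)=s$ for some neighbor $\beta$ of $\alpha$; and to $Y(\alpha)$ otherwise. If $T$ is increasing of shape $\nu/\lambda$ with values in $[p,q]$ and $C$ is a set of maximal boxes of $\lambda$, the forward slide $\mathrm{jdt}_C(T)$ is obtained by adding the boxes of $C$ filled with $\bullet$, applying $\mathrm{swap}_{p,\bullet},\mathrm{swap}_{p+1,\bullet},\dots,\mathrm{swap}_{q,\bullet}$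 in this order, and deleting all boxes containing $\bullet$. The result is an increasing tableau. A rectification of $T$ is any tableau of straight shape obtained from $T$ by a sequence of forward slides. An increasing tableau $U$ of straight shape is a unique rectification target if, for every increasing tableau $T$ that has $U$ as a rectification, $U$ is the only rectification of $T$. **Fat hooks.** A fat hook is a partition of the form $\lambda=(a^b,c^d)$ ($b$ rows of length $a$ followed by $d$ rows of length $c$), where $a,b,c,d$ are non-negative integers with $a\ge c$. $M_\lambda$ is the minimal increasing tableau of shape $\lambda$, $M_\lambda([r,s])=r+s-1$. An increasing tableau $U$ of straight shape fits in the corner of $M_\lambda$ if $U$ has at most $d$ rows, at most $a-c$ columns, and all integers contained in $U$ are strictly larger than the integers contained in $M_\lambda$. In this case $M_\lambda\cup U$ denotes the increasing tableau of straight shape obtained by attaching $U$ to the corner of $M_\lambda$: it agrees with $M_\lambda$ on $\lambda$ and has value $U([i,j])$ in box $[b+i,c+j]$ for each box $[i,j]$ of $U$. *)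

(* Defs.v *)
From HB Require Import structures.
From mathcomp Require Import all_boot all_order all_algebra.
From mathcomp Require Import finmap boolp.
From Stdlib Require Import Relations.

Set Implicit Arguments.
Unset Strict Implicit.
Unset Printing Implicit Defensive.

Import Order.TTheory GRing.Theory Num.Theory.
Local Open Scope fset_scope.
Local Open Scope fmap_scope.

(* Boxes are 0-indexed: the box in row r and column c (r, c >= 1) of the
   quadrant is the pair (r - 1, c - 1).  [*p] is the componentwise order. *)
Notation box := (nat *p nat)%type.

Definition straight (A : {fset box}) : Prop :=
  forall x y : box, (x <= y)%O -> y \in A -> x \in A.

Definition skew_presentation (nu la A : {fset box}) : Prop :=
  [/\ straight nu, straight la, la `<=` nu & A = nu `\` la].

Definition skew_shape (A : {fset box}) : Prop :=
  exists nu la : {fset box}, skew_presentation nu la A.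

Definition increasing (T : {fmap box -> int}) : Prop :=
  forall x y : domf T, (val x < val y)%O -> (T x < T y)%R.

Definition increasing_tableau (T : {fmap box -> int}) : Prop :=
  skew_shape (domf T) /\ increasing T.

Definition covers (x y : box) : Prop :=
  (x < y)%O /\ forall z : box, ~ (x < z < y)%O.

Definition neighbor (x y : box) : Prop := covers x y \/ covers y x.

Definition has_neighbor_valued (S : eqType) (Y : {fmap box -> S}) (x : box)
    (s : S) : Prop :=
  exists2 y : domf Y, neighbor x (val y) & Y y = s.

Definition swap (S : eqType) (s s' : S) (Y : {fmap box -> S}) :
    {fmap box -> S} :=
  [fmap x : domf Y =>
     if (Y x == s) && `[< has_neighbor_valued Y (val x) s' >] then s'
     else if (Y x == s') && `[< has_neighbor_valued Y (val x) s >] then s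
     else Y x].

(* The increasing sequence p, p + 1, ..., q, empty if q < p. *)
Definition int_range (p q : int) : seq int :=
  if (p <= q)%R then [seq (p + i%:Z)%R | i <- iota 0 `|q - p|%N.+1] else [::].

(* In the tableaux with values in [option int], the bullet is [None]. *)
Definition add_bullets (C : {fset box}) (T : {fmap box -> int}) :
    {fmap box -> option int} :=
  [fmap x : domf T => Some (T x)] + [fmap x : C => None].

Definition delete_bullets (Y : {fmap box -> option int}) :
    {fmap box -> int} :=
  [fmap x : [fset y in domf Y | Y.[? y] != Some None] =>
     odflt 0%R (odflt None Y.[? val x])].

Definition jdt (p q : int) (C : {fset box}) (T : {fmap box -> int}) :
    {fmap box -> int} :=
  delete_bullets
    (foldl (fun Y s => swap (Some s) None Y) (add_bullets C T) (int_range p q)).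

Definition maximal_box (la : {fset box}) (x : box) : Prop :=
  x \in la /\ forall y : box, y \in la -> ~ (x < y)%O.

(* [domf T] may be of the form nu / la for several pairs (nu, la); any of them
   may be used to slide.  The interval [p, q] is any one containing the values
   of T. *)
Definition forward_slide (T T' : {fmap box -> int}) : Prop :=
  exists (nu la C : {fset box}) (p q : int),
    [/\ skew_presentation nu la (domf T),
        increasing T,
        forall x : domf T, (p <= T x <= q)%R,
        forall x : box, x \in C -> maximal_box la x
      & T' = jdt p q C T].

Definition rectification (T R : {fmap box -> int}) : Prop :=
  clos_refl_trans _ forward_slide T R /\ straight (domf R).

Definition unique_rectification_target (U : {fmap box -> int}) : Prop :=
  [/\ increasing_tableau U,
      straight (domf U)
    & forall T, increasing_tableau T -> rectification T U ->
        forall V, rectification T V -> V = U].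

(* The Young diagram with row lengths s. *)
Definition young (s : seq nat) : {fset box} :=
  [fset x in [seq (i, j) : box | i <- iota 0 (size s), j <- iota 0 (nth 0 s i)]].

(* The partition (a^b, c^d). *)
Definition fat_hook (a b c d : nat) : {fset box} :=
  young (nseq b a ++ nseq d c).

(* In 1-indexed coordinates, the box [r, s] has value r + s - 1. *)
Definition minimal_tableau (la : {fset box}) : {fmap box -> int} :=
  [fmap x : la => (((val x).1 + (val x).2 + 1)%N%:Z)%R].

Definition nrows (A : {fset box}) : nat := #|` [fset x.1 | x in A]|.

Definition ncols (A : {fset box}) : nat := #|` [fset x.2 | x in A]|.

Definition fits_in_corner (a b c d : nat) (U : {fmap box -> int}) : Prop :=
  [/\ increasing_tableau U,
      straight (domf U),
      nrows (domf U) <= d,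
      ncols (domf U) <= a - c
    & forall (x : domf U) (y : domf (minimal_tableau (fat_hook a b c d))),
        (minimal_tableau (fat_hook a b c d) y < U x)%R].

(* The translate of U whose value in box [b + i, c + j] is U([i, j]). *)
Definition translate (b c : nat) (U : {fmap box -> int}) :
    {fmap box -> int} :=
  [fmap x : [fset ((b + y.1, c + y.2)%N : box) | y in domf U] =>
     odflt 0%R U.[? ((val x).1 - b, (val x).2 - c)%N]].

(* M_la `union` U for la = (a^b, c^d).  When U fits in the corner, the two
   maps have disjoint domains. *)
Definition attach (a b c d : nat) (U : {fmap box -> int}) :
    {fmap box -> int} :=
  minimal_tableau (fat_hook a b c d) + translate b c U.

(* Main.v *)
Require Import Defs.
From HB Require Import structures.
From mathcomp Require Import all_boot all_order all_algebra finmap boolp zify.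
From Stdlib Require Import Relations.

(** Let [T] rectify to [N], the union of the minimal tableau and [U], and to
    [V].  Two invariants of slides are used, each for the entries with values
    in a given interval: the maximal length of an increasing chain of the
    reading word (and, by transposition, of a decreasing one), and the product
    of the 0-Hecke operators along the reading word.  Chains bound the shape of
    [V] by that of the (b + d) x a rectangle and, applied to intervals of a
    (resp. b + d) consecutive values, force [V] to contain the minimal tableau;
    the 0-Hecke operators then exclude small values in the corner of [V].
    Finally, slides restrict to the entries with large values, and a translated
    straight tableau slides back to the origin, so [U] and the corner of [V]
    are rectifications of the same tableau.

    Both invariances are proved swap by swap.  Midway through a slide the
    entries already moved and those not yet moved do not form a reading word
    equivalent to the initial one: a moved entry with a bullet below it must
    also be read one row lower (its ghost). *)

Set Implicit Arguments.
Unset Strict Implicit.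
Unset Printing Implicit Defensive.

Import Order.TTheory GRing.Theory Num.Theory.

(** * Swaps on fillings of the quadrant *)

(** The hypothesis on [U] applies only to tableaux that rectify to [U] itself, hence to the part of
    [T] above some value [m]. It says something about [V] only if cutting at [m] splits [V] exactly
    along the border of its corner. The difficulty is thus to show that [V] is minimal on the hook
    and that its corner holds nothing smaller than the values of [U]. Chains alone do not settle the
    second point: if a small corner value also occurs in both arms of the hook, the chains that
    would detect the extra copy exist in [N] as well. The 0-Hecke product does detect it, and a
    single well-chosen configuration of particles is enough to see the difference. A ghost is an
    entry counted in two rows as long as the bullet stays below it. When the bullet moves on to the
    right, the ghost passes to a larger entry; for consecutive values this passage is the braid
    relation. *)

Definition fill := nat -> nat -> option (option int).

Notation bullet := (Some (None : option int)).
Notation entry v := (Some (Some v : option int)).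

(** The order on contents just before the swap with [s]: the bullet ([None]) acts as a value
    strictly between [s - 1] and [s], and two bullets are never comparable. *)
Definition cell_lt (s : int) (c c' : option int) : Prop :=
  match c, c' with
  | Some u, Some v => (u < v)%R
  | None, Some v => (s <= v)%R
  | Some u, None => (u < s)%R
  | None, None => False
  end.

Record good (s : int) (Y : fill) : Prop := Good {
  good_convex : forall i j i1 j1 i2 j2, i <= i1 <= i2 -> j <= j1 <= j2 ->
    Y i j <> None -> Y i2 j2 <> None -> Y i1 j1 <> None;
  good_lt : forall i j i1 j1 c c', i <= i1 -> j <= j1 -> (i, j) <> (i1, j1) ->
    Y i j = Some c -> Y i1 j1 = Some c' -> cell_lt s c c' }.

(** On good fillings this is [swap], although only half of the neighbors are tested: everything to
    the left of or above a bullet is smaller than [s], so an adjacent [s] can only be to its right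
    or below it. *)
Definition step (s : int) (Y : fill) : fill := fun i j =>
  match Y i j with
  | None => None
  | Some None =>
      if (Y i j.+1 == entry s) || (Y i.+1 j == entry s) then entry s
      else bullet
  | Some (Some v) =>
      if (v == s) && ((0 < j) && (Y i j.-1 == bullet)
                      || (0 < i) && (Y i.-1 j == bullet)) then bullet
      else entry v
  end.

Lemma good_row s Y i j c c' (gY : good s Y) :
  Y i j = Some c -> Y i j.+1 = Some c' -> cell_lt s c c'.
Proof. by apply: (good_lt gY) => // -[]; lia. Qed.

Lemma good_col s Y i j c c' (gY : good s Y) :
  Y i j = Some c -> Y i.+1 j = Some c' -> cell_lt s c c'.
Proof. by apply: (good_lt gY) => // -[]; lia. Qed.

Lemma step_None s Y i j : (step s Y i j = None) <-> (Y i j = None).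
Proof.
rewrite /step; case: (Y i j) => [[v|]|] //; by case: ifP.
Qed.

Lemma step_other s Y i j v : v <> s -> (step s Y i j = entry v) <-> (Y i j = entry v).
Proof.
move=> vs; rewrite /step; case: (Y i j) => [[u|]|] //.
- case: ifP => // /andP[/eqP us _]; split => // -[]; congruence.
- by case: ifP => // _; split => // -[]; congruence.
Qed.

(* A bullet and an [s] that are comparable are adjacent, since no value lies between them. *)
Lemma good_bullet_s s Y i j i1 j1 (gY : good s Y) :
  i <= i1 -> j <= j1 -> Y i j = bullet -> Y i1 j1 = entry s ->
  (i1 = i /\ j1 = j.+1) \/ (i1 = i.+1 /\ j1 = j).
Proof.
move=> ii jj Yb Ys.
have between k l : i <= k <= i1 -> j <= l <= j1 -> (i, j) <> (k, l) ->
    (k, l) = (i1, j1).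
  move=> ki lj ne; apply: contrapT => ne'.
  have : Y k l <> None.
    by apply: (good_convex gY ki lj); rewrite ?Yb ?Ys.
  case E: (Y k l) => [c|//] _.
  have [ik ki1] := andP ki; have [jl lj1] := andP lj.
  have := good_lt gY ik jl ne Yb E; have := good_lt gY ki1 lj1 ne' E Ys.
  by case: c E => [c|] //= _; lia.
have [E|ne] := eqVneq i i1.
  left; subst i1; split=> //.
  have [E|ne] := eqVneq j j1; first by subst j1; congruence.
  by have [] : (i, j.+1) = (i, j1) by apply: between; [lia|lia|case; lia].
by right; have [] : (i.+1, j) = (i1, j1) by apply: between; [lia|lia|case; lia].
Qed.

Lemma step_bullet_to_s s Y i j i1 j1 (gY : good s Y) :
  i <= i1 -> j <= j1 -> Y i j = bullet -> Y i1 j1 = entry s ->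
  step s Y i j = entry s /\ step s Y i1 j1 = bullet.
Proof.
move=> ii jj Yb Ys; have := good_bullet_s gY ii jj Yb Ys; rewrite /step Yb Ys eqxx.
by case=> -[? ?]; subst i1 j1 => /=; rewrite Yb Ys !eqxx ?orbT ?andbT /= ?orbT.
Qed.

Lemma good_step s Y : good s Y -> good (s + 1)%R (step s Y).
Proof.
move=> gY; split=> [i j i1 j1 i2 j2 Hi Hj | i j i1 j1 c c' Hi Hj ne].
  by rewrite !step_None; exact: (good_convex gY).
case E: (Y i j) => [d|]; last by move/step_None: E => ->.
case E': (Y i1 j1) => [d'|]; last by move=> _; move/step_None: E' => ->.
have lt := good_lt gY Hi Hj ne E E'.
(* A bullet followed by an [s] is the only pair whose order could break, and there both cells are
   exchanged. For any other pair the inequality survives whichever of the two cells changes. *)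
have [[Ed Ed']|H] := pselect (d = None /\ d' = Some s).
  by subst d d'; have [-> ->] := step_bullet_to_s gY Hi Hj E E' => -[<-] [<-] /=; lia.
have aux k l e e1 : Y k l = Some e -> step s Y k l = Some e1 ->
    e1 = e \/ (e = None /\ e1 = Some s) \/ (e = Some s /\ e1 = None).
  rewrite /step => ->; case: e => [v|]; case: ifP.
  - by move=> /andP[/eqP -> _] [<-]; tauto.
  - by move=> _ [<-]; tauto.
  - by move=> _ [<-]; tauto.
  - by move=> _ [<-]; tauto.
move=> /(aux _ _ _ _ E) h1 /(aux _ _ _ _ E') h2 {aux E E'}.
case: d c d' c' lt H h1 h2 => [d|] [c|] [d'|] [c'|] /= lt H h1 h2;
 repeat match goal with
 | H : _ \/ _ |- _ => destruct H | H : _ /\ _ |- _ => destruct H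
 | H : Some _ = Some _ |- _ => case: H => H
 | H : Some _ = None |- _ => discriminate H | H : None = Some _ |- _ => discriminate H end;
 subst; try lia; try by case: H.
- by have : d' <> s by [move=> E; apply: H; rewrite E]; lia.
- by have : d' <> s by [move=> E; apply: H; rewrite E]; lia.
Qed.

(** * Increasing chains are preserved by slides *)

Definition has_entry (Y : fill) (i : nat) (v : int) : Prop :=
  exists j, Y i j = entry v.

(* [chain R x m n i]: there are m entries with values in [x, x + n) in rows
   >= i, increasing in value and weakly going up; the recursion peels off the
   largest one. *)
Fixpoint chain (R : nat -> int -> Prop) (x : int) (m n i : nat) : Prop :=
  if m is m'.+1 then
    exists t k, [/\ t < n, i <= k, R k (x + t%:Z)%R & chain R x m' t k]
  else True.

Lemma chain_mono R x m n n1 i i1 :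
  n <= n1 -> i1 <= i -> chain R x m n i -> chain R x m n1 i1.
Proof.
case: m => [|m] //= nn ii [t [k [? ? ? ?]]]; exists t, k; split => //; lia.
Qed.

Lemma chain_imp R R1 x m n i :
  (forall t k, t < n -> i <= k -> R k (x + t%:Z)%R -> R1 k (x + t%:Z)%R) ->
  chain R x m n i -> chain R1 x m n i.
Proof.
elim: m n i => [|m IH] //= n i H [t [k [tn ik Rk ch]]].
exists t, k; split => //; first exact: H.
by apply: IH ch => t1 k1 ? ?; apply: H; lia.
Qed.

Lemma chain_last R x m n i :
  chain R x m n.+1 i <-> chain R x m n i \/
  exists m1 k, [/\ m = m1.+1, i <= k, R k (x + n%:Z)%R & chain R x m1 n k].
Proof.
split.
  case: m => [|m] /=; first by left.
  case=> t [k [tn ik Rk ch]]; have [E|ne] := eqVneq t n.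
    by subst t; right; exists m, k.
  by left; exists t, k; split => //; lia.
case=> [|[m1 [k [-> ik Rk ch]]]]; first by apply: chain_mono; lia.
by exists n, k.
Qed.

Lemma good_row_inv s Y k c c1 v w (gY : good s Y) :
  Y k c = entry v -> Y k c1 = entry w -> (v < w)%R -> c < c1.
Proof.
move=> E E1 vw; rewrite ltnNge; apply/negP => le.
have [e|ne] := eqVneq c c1; first by subst c1; move: E1; rewrite E => -[]; lia.
have : cell_lt s (Some w) (Some v) by apply: (good_lt gY _ le _ E1 E) => //; case; lia.
by rewrite /=; lia.
Qed.

Lemma good_row_bullet s Y k c c1 v (gY : good s Y) :
  Y k c = bullet -> Y k c1 = entry v -> (v < s)%R -> c1 < c.
Proof.
move=> E E1 vs; rewrite ltnNge; apply/negP => le.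
have [e|ne] := eqVneq c c1; first by subst c1; move: E1; rewrite E.
have : cell_lt s None (Some v) by apply: (good_lt gY _ le _ E E1) => //; case; lia.
by rewrite /=; lia.
Qed.

Lemma good_row_bullet_s s Y k j c (gY : good s Y) :
  Y k j = bullet -> Y k c = entry s -> c = j.+1.
Proof.
move=> b e; have [le|lt] := leqP j c; first by case: (good_bullet_s gY (leqnn k) le b e); lia.
have /= : cell_lt s (Some s) None; last by lia.
by apply: (good_lt gY (leqnn k) (ltnW lt) _ e b); case; lia.
Qed.

Lemma good_row_bullets s Y k j c (gY : good s Y) :
  Y k j = bullet -> Y k c = bullet -> c = j.
Proof.
move=> b e; apply/eqP; rewrite eqn_leq; apply/andP; split; rewrite leqNgt; apply/negP => lt.
- by apply: (good_lt gY (leqnn k) (ltnW lt) _ b e); case; lia.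
- by apply: (good_lt gY (leqnn k) (ltnW lt) _ e b); case; lia.
Qed.

Lemma good_square s Y i j i1 j1 i2 j2 (gY : good s Y) :
  i <= i1 <= i2 -> j <= j1 <= j2 ->
  Y i j <> None -> Y i2 j2 <> None -> exists c, Y i1 j1 = Some c.
Proof.
move=> H H' h h2; have : Y i1 j1 <> None by apply: (good_convex gY H H' h h2).
by case E: (Y i1 j1) => [c|] // _; exists c.
Qed.

(** The part of the chain in row [k] lies to the left of column [c]. Each of its entries can be
    replaced by the one below it, which is larger but still left of box [(k + 1, c)], hence smaller
    than [x + u1]. That box is not a bullet, since nothing smaller than [s] follows a bullet. *)
Lemma chain_down x s Y (gY : good s Y) k c u u1 m :
  Y k c = entry (x + u%:Z)%R -> Y k.+1 c = entry (x + u1%:Z)%R ->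
  (x + u1%:Z < s)%R ->
  chain (has_entry Y) x m u k -> chain (has_entry Y) x m u1 k.+1.
Proof.
elim/ltn_ind: c k u u1 m => c IH k u u1 [|m] //= E E1 us [t [k1 [tu kk [c1 Ec] ch]]].
have uu : u < u1 by have := good_col gY E E1 => /=; lia.
have [e|ne] := eqVneq k1 k; last by exists t, k1; split => //; [lia|lia|exists c1].
subst k1; have cc : c1 < c by apply: (good_row_inv gY Ec E); lia.
have [d Ed] : exists d, Y k.+1 c1 = Some d.
  by apply: (good_square (i := k) (j := c1) (i2 := k.+1) (j2 := c) gY); rewrite ?Ec ?E1 //; lia.
have l1 : cell_lt s d (Some (x + u1%:Z)%R).
  by apply: (good_lt gY _ _ _ Ed E1); [lia|lia|case; lia].
have l2 := good_col gY Ec Ed.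
case: d Ed l1 l2 => [w|] Ed /= l1 l2; last lia.
have Ew : w = (x + (`|w - x|%N)%:Z)%R by lia.
exists `|w - x|%N, k.+1; split => //; first lia; first by exists c1; rewrite -Ew.
by apply: (IH _ cc k t _ m _ _ _ ch) => //; rewrite -?Ew // ; lia.
Qed.

(* A bullet in box (i, j) lets a chain that ends in the box above continue to
   the entries of row i that have not been moved yet. *)
Definition ghost_chain (Y : fill) x m n i : Prop :=
  exists m1 i1 j u, [/\ m = m1.+1, i = i1.+1, Y i j = bullet,
    Y i1 j = entry (x + u%:Z)%R & u < n /\ chain (has_entry Y) x m1 u i1].

Definition slid_chain (Y : fill) x m n i : Prop :=
  chain (has_entry Y) x m n i \/ ghost_chain Y x m n i.

Lemma has_entry_step s Y i v : v <> s ->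
  has_entry (step s Y) i v <-> has_entry Y i v.
Proof.
by move=> vs; split => -[j E]; exists j; move: E; rewrite step_other.
Qed.

Lemma chain_step x n Y m n1 i : n1 <= n ->
  chain (has_entry (step (x + n%:Z)%R Y)) x m n1 i <-> chain (has_entry Y) x m n1 i.
Proof.
by move=> nn; split; apply: chain_imp => t k tn _; rewrite has_entry_step //; lia.
Qed.

Lemma step_s_cases s Y i j (gY : good s Y) : step s Y i j = entry s ->
  [\/ Y i j = entry s, Y i j = bullet /\ Y i j.+1 = entry s
    | Y i j = bullet /\ Y i.+1 j = entry s].
Proof.
rewrite /step; case E: (Y i j) => [[v|]|] //; case: ifP => //.
- by move=> _ [->]; constructor 1.
- by case/orP => /eqP ->; [constructor 2|constructor 3].
Qed.

Lemma step_bullet_cases s Y i j (gY : good s Y) : step s Y i j = bullet ->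
  [\/ [/\ Y i j = bullet, Y i j.+1 <> entry s & Y i.+1 j <> entry s],
      exists2 j1, j = j1.+1 & Y i j = entry s /\ Y i j1 = bullet
    | exists2 i1, i = i1.+1 & Y i j = entry s /\ Y i1 j = bullet].
Proof.
rewrite /step; case E: (Y i j) => [[v|]|] //; case: ifP => //.
- move=> /andP[/eqP -> /orP[]/andP[h /eqP b]] _.
  + by constructor 2; exists j.-1; [lia|].
  + by constructor 3; exists i.-1; [lia|].
- by move=> /norP[/eqP ? /eqP ?] _; constructor 1.
Qed.

Lemma step_s_stay s Y i j : Y i j = entry s ->
  (forall j1, j = j1.+1 -> Y i j1 <> bullet) ->
  (forall i1, i = i1.+1 -> Y i1 j <> bullet) -> step s Y i j = entry s.
Proof.
move=> E hj hi; rewrite /step E eqxx /=; case: ifP => // /orP[]/andP[h /eqP b].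
- by case: (hj j.-1) => //; lia.
- by case: (hi i.-1) => //; lia.
Qed.

(** When the bullet below the ghost [v] moves right, the entry [w] above its new box takes over as
    ghost. *)
Lemma step_above_right s Y i j v (gY : good s Y) :
  Y i.+1 j = bullet -> Y i.+1 j.+1 = entry s -> Y i j = entry v ->
  exists2 w, step s Y i j.+1 = entry w & (v < w <= s)%R.
Proof.
move=> b e a.
have [c Ec] : exists c, Y i j.+1 = Some c.
  by apply: (good_square (i := i) (j := j) (i2 := i.+1) (j2 := j.+1) gY); rewrite ?a ?e //; lia.
have vs : (v < s)%R by have := good_col gY a b.
case: c Ec => [w|] Ec.
  have l := good_row gY a Ec; have /= l1 := good_col gY Ec e.
  exists w; last by move: l => /=; lia.
  by rewrite step_other //; lia.
exists s; last lia.
by have [] := step_bullet_to_s gY (leqnSn i) (leqnn j.+1) Ec e.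
Qed.

(** [R] stays fixed as the initial row content, so that the step can be iterated; all row bounds [i]
    are needed, because peeling off the largest entry leaves a chain bounded by the row of that
    entry. If the bullet under a ghost is filled from the right, the ghost passes to the next
    column; if it is filled from below, the new [s] replaces the ghost and [chain_down] lowers the
    rest. *)
Lemma slid_chain_step x n Y (R : nat -> int -> Prop) (gY : good (x + n%:Z)%R Y) :
  (forall k, R k (x + n%:Z)%R <-> has_entry Y k (x + n%:Z)%R) ->
  (forall m i, chain R x m n i <-> slid_chain Y x m n i) ->
  forall m i, chain R x m n.+1 i <-> slid_chain (step (x + n%:Z)%R Y) x m n.+1 i.
Proof.
set s := (x + n%:Z)%R => HR IH m i; set Y1 := step s Y.
have gY1 : good (s + 1)%R Y1 by exact: good_step.
have mono m1 i1 i2 n1 : i2 <= i1 -> n1 <= n -> chain (has_entry Y) x m1 n1 i1 ->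
    chain (has_entry Y1) x m1 n.+1 i2.
  by move=> ii nn H; apply: chain_mono (ltnW (ltnSn n)) ii _; apply/chain_step => //;
     apply: chain_mono nn _ H.
have back m1 i1 n1 : n1 <= n -> chain (has_entry Y1) x m1 n1 i1 ->
    chain (has_entry Y) x m1 n1 i1 by move=> nn /chain_step; exact.
have right i1 j u m1 : Y i1.+1 j = bullet -> Y i1.+1 j.+1 = entry s ->
    Y i1 j = entry (x + u%:Z)%R -> u < n -> chain (has_entry Y) x m1 u i1 ->
    exists u1, [/\ Y1 i1 j.+1 = entry (x + u1%:Z)%R, u < u1 <= n &
                   chain (has_entry Y1) x m1.+1 u1 i1].
  move=> b e a un ch; have [w Ew /andP[vw ws]] := step_above_right gY b e a.
  have Eu : w = (x + (`|w - x|%N)%:Z)%R by lia.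
  exists `|w - x|%N; split; [by rewrite -Eu|lia|].
  exists u, i1; split => //; first lia; last by apply/chain_step => //; lia.
  by exists j; apply/step_other; [lia|].
rewrite chain_last IH; split.
- case=> [[ch|[m1 [i1 [j [u [-> Ei b a [un ch]]]]]]]|[m1 [k [-> ik Rk ch]]]].
  + by left; apply: mono ch.
  + subst i; case e: (Y1 i1.+1 j == bullet).
      right; exists m1, i1, j, u; split => //; first exact/eqP.
        by apply/step_other => //; lia.
      by split; [lia|]; apply/chain_step => //; lia.
    have bs : Y1 i1.+1 j = entry s.
      by move: e; rewrite /Y1 /step b; case: ifP.
    have [|[_ e1]|[_ e1]] := step_s_cases gY bs; first by rewrite b.
      have [u1 [a1 uu ch1]] := right _ _ _ _ b e1 a un ch.
      right; exists m1, i1, j.+1, u1; split => //.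
      * by have [] := step_bullet_to_s gY (leqnn _) (leqnSn j) b e1.
      * split; [lia|]; apply/chain_step; [lia|].
        by apply: chain_mono ch; lia.
    left; exists n, i1.+1; split => //; first by exists j.
    have a1 : Y1 i1 j = entry (x + u%:Z)%R by apply/step_other => //; lia.
    by apply: (chain_down gY1 a1 bs); [lia|apply/chain_step => //; lia].
  + have [c Ec] : has_entry Y k s by apply/HR.
    have /IH {}ch := ch.
    (* If [s] moves left, a ghost ending the remaining chain must use this very bullet, a row having
       only one. The entry above the vacated box then takes the place of [s] at the end of the
       chain. *)
    case: (boolP ((0 < c) && (Y k c.-1 == bullet))) => [/andP[c0 /eqP b]|nleft].
      case: c c0 Ec b => // c _ Ec /= b.
      have [s1 b1] := step_bullet_to_s gY (leqnn _) (leqnSn c) b Ec.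
      case: ch => [ch|[m2 [i1 [j [u [-> Ei b2 a [un ch]]]]]]].
        by left; exists n, k; split => //; [exists c|apply/chain_step].
      subst k; have Ej : j = c by apply: (good_row_bullets gY b b2).
      subst j; have [u1 [a1 uu ch1]] := right _ _ _ _ b Ec a un ch.
      have [e|ne] := eqVneq i i1.+1.
        subst i; right; exists m2.+1, i1, c.+1, u1; split => //.
        by split => //; lia.
      by left; exists u1, i1; split => //; [lia|lia|by exists c.+1].
    have {}ch : chain (has_entry Y) x m1 n k.
      case: ch => // -[m2 [i1 [j [u [_ Ei b2 _ _]]]]].
      have Ec1 := good_row_bullet_s gY b2 Ec; subst c.
      by case/negP: nleft; rewrite /= b2.
    case: (boolP ((0 < k) && (Y k.-1 c == bullet))) => [/andP[k0 /eqP b]|nup].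
      case: k k0 Ec b {Rk nleft} ik ch => // k _ Ec /= b ik ch.
      have [s1 b1] := step_bullet_to_s gY (leqnSn k) (leqnn c) b Ec.
      have [e|ne] := eqVneq i k.+1.
        subst i; right; exists m1, k, c, n; split => //.
        by split => //; apply/chain_step => //; apply: chain_mono ch.
      left; exists n, k; split => //; [lia|by exists c|apply/chain_step => //].
      by apply: chain_mono ch.
    left; exists n, k; split => //; last by apply/chain_step.
    exists c; apply: step_s_stay => // [c1|k1] E b; subst.
      by case/negP: nleft; rewrite /= b.
    by case/negP: nup; rewrite /= b.
- have under i1 c1 t m2 d : Y i1 c1 = entry (x + t%:Z)%R -> Y i1.+1 c1 = Some d ->
      cell_lt s d (Some s) -> t < n -> chain (has_entry Y) x m2 t i1 ->
      slid_chain Y x m2.+1 n i1.+1.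
    move=> a e l tn ch; case: d e l => [w|] e /= l; last first.
      by right; exists m2, i1, c1, t.
    have l2 := good_col gY a e.
    have Ew : w = (x + (`|w - x|%N)%:Z)%R by move: l2 => /=; lia.
    left; exists `|w - x|%N, i1.+1; split => //; first lia.
      by exists c1; rewrite -Ew.
    by apply: (chain_down gY a _ _ ch); rewrite -Ew.
  (* For an [s] that has just risen from row [k + 1]: the chain preceding it in row [k] lies to the
     left of it, where row [k + 1] has boxes by convexity, all smaller than [s]. So [under]
     applies. *)
  have down k j m1 n1 : Y k.+1 j = entry s -> n1 <= n ->
      (forall c1 t, t < n1 -> Y k c1 = entry (x + t%:Z)%R -> c1 < j) ->
      chain (has_entry Y) x m1 n1 k -> slid_chain Y x m1 n k.+1.
    move=> e nn left_j; case: m1 => [|m1]; first by left.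
    case=> t [k1 [tn kk [c1 Ec] ch]].
    have [ek|ne] := eqVneq k1 k; last first.
      by left; exists t, k1; split => //; [lia|lia|exists c1].
    subst k1; have cj := left_j _ _ tn Ec.
    have [d Ed] : exists d, Y k.+1 c1 = Some d.
      by apply: (good_square (i := k) (j := c1) (i2 := k.+1) (j2 := j) gY); rewrite ?Ec ?e //; lia.
    apply: (under _ _ _ _ _ Ec Ed) ch; last lia.
    by apply: (good_lt gY (leqnn _) (ltnW cj) _ Ed e); case; lia.
  case=> [/chain_last[ch|[m1 [k [-> ik [c Ec] ch]]]]|[m1 [i1 [j [u [-> Ei b a [un ch]]]]]]].
  + by left; left; apply: back.
  + move/(back _ _ _ (leqnn n)): ch => ch; right.
    have [e|[b e]|[b e]] := step_s_cases gY Ec.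
    * exists m1, k; split => //; first by apply/HR; exists c.
      by apply/IH; left.
    * exists m1, k; split => //; first by apply/HR; exists c.+1.
      by apply/IH; left.
    * exists m1, k.+1; split => //; first lia; first by apply/HR; exists c.
      apply/IH; apply: (down _ _ _ _ e (leqnn n)) ch => c1 t tn E.
      by apply: (good_row_bullet gY b E); lia.
  + subst i; have {}un : u <= n by lia.
    have {}ch := back _ _ _ un ch.
    have viaR : Y i1.+1 j = entry s -> exists m2 k, [/\ m1.+1 = m2.+1, i1 < k,
        R k s & chain R x m2 n k].
      move=> e; exists m1, i1.+1; split => //; first by apply/HR; exists j.
      apply/IH; apply: (down _ _ _ _ e un) ch => c1 t tu E.
      apply: (good_row_inv gY1 (v := (x + t%:Z)%R) _ a); last lia.
      by apply/step_other => //; lia.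
    have [[b1 _ _]|[c _ [e b1]]|[k Ek [e b1]]] := step_bullet_cases gY b; [|by right; exact: viaR..].
    left; right; have ne : u <> n.
      move=> E; subst u; have [e|[e _]|[e _]] := step_s_cases gY a;
      by have /= := good_col gY e b1; lia.
    exists m1, i1, j, u; split => //; last by split => //; lia.
    by move: a; rewrite step_other //; lia.
Qed.

Definition slide_seq (x : int) (Y : nat -> fill) : Prop :=
  good x (Y 0) /\ forall t, Y t.+1 = step (x + t%:Z)%R (Y t).

Lemma slide_seq_good x Y t : slide_seq x Y -> good (x + t%:Z)%R (Y t).
Proof.
case=> g st; elim: t => [|t IH]; first by rewrite addr0.
have -> : (x + t.+1%:Z = x + t%:Z + 1)%R by lia.
by rewrite st; apply: good_step.
Qed.

Lemma slide_seq_before x Y t i j v : slide_seq x Y -> (x + t%:Z <= v)%R ->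
  Y t i j = entry v <-> Y 0 i j = entry v.
Proof.
case=> g st; elim: t => [|t IH] // le.
by rewrite st step_other ?IH //; lia.
Qed.

Lemma slide_seq_after x Y t n i j v : slide_seq x Y -> (v < x + t%:Z)%R -> t <= n ->
  Y n i j = entry v <-> Y t i j = entry v.
Proof.
case=> g st lt; elim: n => [|n IH] le; first by have -> : t = 0 by lia.
have [->//|ne] := eqVneq t n.+1.
by rewrite st step_other ?IH //; lia.
Qed.

Lemma slide_seq_chain x Y n m : slide_seq x Y ->
  chain (has_entry (Y 0)) x m n 0 <-> chain (has_entry (Y n)) x m n 0.
Proof.
move=> sq; suff H t : t <= n -> forall m i,
    chain (has_entry (Y 0)) x m t i <-> slid_chain (Y t) x m t i.
  (* With row bound 0 there is no ghost, as a ghost needs a row above. *)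
  rewrite H //; split; last by left.
  by case=> // -[? [? [? [? []]]]].
elim: t => [|t IH] tn k i.
  split; first by left.
  by case=> // -[? [? [? [? [? ? ? ? []]]]]].
have [_ st] := sq; rewrite st; apply: slid_chain_step.
- exact: slide_seq_good.
- by move=> r; split => -[j E]; exists j; move: E; rewrite (slide_seq_before _ _ sq (lexx (x + t%:Z)%R)).
- by move=> m1 i1; apply: IH; lia.
Qed.

(** * The 0-Hecke operators of a tableau are preserved by slides *)

Definition sites := int -> bool.

(* The letter [l] moves a particle from site [l] to site [l + 1] if the latter
   is empty; these operators satisfy the 0-Hecke relations. *)
Definition act (l : int) (S : sites) : sites := fun z =>
  if z == l then S l && S (l + 1)%R
  else if z == (l + 1)%R then S l || S (l + 1)%R else S z.

(** Composition in reading order: the left factor acts first. It is locked so that simplification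
    leaves products alone. *)
HB.lock Definition op (f g : sites -> sites) : sites -> sites := fun S => g (f S).

Lemma opE f g S : op f g S = g (f S). Proof. by rewrite op.unlock. Qed.

Local Infix "**" := op (at level 40, left associativity).

Definition rep (b : bool) (f : sites -> sites) : sites -> sites :=
  if b then f else id.

Fixpoint actw (w : seq int) : sites -> sites :=
  if w is l :: w' then act l ** actw w' else id.

Lemma opA f g h : f ** (g ** h) = f ** g ** h. Proof. by rewrite op.unlock. Qed.
Lemma op1f f : id ** f = f. Proof. by rewrite op.unlock. Qed.
Lemma opf1 f : f ** id = f. Proof. by rewrite op.unlock. Qed.

Lemma actw_cat u v : actw (u ++ v) = actw u ** actw v.
Proof. by elim: u => [|l u IH] /=; rewrite ?op1f // IH opA. Qed.

Lemma act_idem l : act l ** act l = act l.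
Proof.
apply/funext => S; apply/funext => z; rewrite !opE /act eqxx.
have -> : (l + 1 == l)%R = false by lia.
rewrite eqxx; case: ifP => [_|h]; first by case E: (S l); case E1: (S (l + 1)%R).
by case: ifP => [_|h1]; [case: (S l); case: (S (l + 1)%R)|rewrite h h1].
Qed.

Lemma act_comm l k : (l + 2 <= k)%R \/ (k + 2 <= l)%R -> act l ** act k = act k ** act l.
Proof.
move=> far; apply/funext => S; apply/funext => z; rewrite !opE /act.
have [-> -> -> ->] : [/\ (l == k) = false, (l == k + 1)%R = false,
  (l + 1 == k)%R = false & (l + 1 == k + 1)%R = false] by split; lia.
have [-> -> -> ->] : [/\ (k == l) = false, (k == l + 1)%R = false,
  (k + 1 == l)%R = false & (k + 1 == l + 1)%R = false] by split; lia.
case: (eqVneq z l) => [->|zl].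
  by have [-> ->] : (l == k) = false /\ (l == k + 1)%R = false by lia.
case: (eqVneq z (l + 1)%R) => [->|zl1] //.
by have [-> ->] : (l + 1 == k)%R = false /\ (l + 1 == k + 1)%R = false by lia.
Qed.

Lemma act_braid l :
  act l ** act (l + 1)%R ** act l = act (l + 1)%R ** act l ** act (l + 1)%R.
Proof.
apply/funext => S; apply/funext => z; have n1 : (l == l + 1)%R = false by lia.
have n2 : (l == l + 1 + 1)%R = false by lia.
have n3 : (l + 1 == l)%R = false by lia.
have n4 : (l + 1 + 1 == l)%R = false by lia.
have n5 : (l + 1 == l + 1 + 1)%R = false by lia.
have n6 : (l + 1 + 1 == l + 1)%R = false by lia.
rewrite !opE /act !(eqxx, n1, n2, n3, n4, n5, n6).
have [E|h1] := eqVneq z l.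
  by rewrite ?E ?(eqxx, n1, n2); case: (S l); case: (S (l + 1)%R); case: (S (l + 1 + 1)%R).
have [E|h2] := eqVneq z (l + 1)%R.
  by rewrite ?E ?(eqxx, n5); case: (S l); case: (S (l + 1)%R); case: (S (l + 1 + 1)%R).
have [_|//] := eqVneq z (l + 1 + 1)%R.
by case: (S l); case: (S (l + 1)%R); case: (S (l + 1 + 1)%R).
Qed.

Lemma actw_comm w l : {in w, forall k, (l + 2 <= k)%R \/ (k + 2 <= l)%R} ->
  actw w ** act l = act l ** actw w.
Proof.
elim: w => [|k w IH] /= far; first by rewrite op1f opf1.
rewrite -opA IH ?opA; last by move=> z zw; apply: far; rewrite inE zw orbT.
by rewrite act_comm //; have := far k; rewrite inE eqxx => /(_ isT); lia.
Qed.

Lemma actw_comm_rep b w l : {in w, forall k, (l + 2 <= k)%R \/ (k + 2 <= l)%R} ->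
  actw w ** rep b (act l) = rep b (act l) ** actw w.
Proof. by case: b => /=; [exact: actw_comm|rewrite op1f opf1]. Qed.

Definition ghost_entry (Y : fill) (r : nat) (v : int) : Prop :=
  exists i j, [/\ r = i.+1, Y r j = bullet & Y i j = entry v].

(** The bullet is filled from below and not from the right: row [r] gains an [s] that it did not
    have. *)
Definition rises (s : int) (Y : fill) (r : nat) : Prop :=
  exists j, [/\ Y r j = bullet, Y r.+1 j = entry s & Y r j.+1 <> entry s].

Lemma good_adj_pred s Y r j k (gY : good s Y) :
  Y r j = bullet -> Y r k = entry (s - 1)%R -> j = k.+1.
Proof.
move=> b e; have kj : k < j by apply: (good_row_bullet gY b e); lia.
apply/eqP; rewrite eqn_leq kj andbT leqNgt; apply/negP => lt.
have [c Ec] : exists c, Y r k.+1 = Some c.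
  by apply: (good_square (i := r) (j := k) (i2 := r) (j2 := j) gY); rewrite ?b ?e //; lia.
have l1 := good_row gY e Ec.
have l2 : cell_lt s c None by apply: (good_lt gY (leqnn r) (ltnW lt) _ Ec b); case; lia.
by case: c Ec l1 l2 => [c|] //= _; lia.
Qed.

Lemma good_adj_succ s Y r j k (gY : good s Y) :
  Y r j = entry s -> Y r k = entry (s + 1)%R -> k = j.+1.
Proof.
move=> b e; have kj : j < k by apply: (good_row_inv gY b e); lia.
apply/eqP; rewrite eqn_leq kj andbT leqNgt; apply/negP => lt.
have [c Ec] : exists c, Y r j.+1 = Some c.
  by apply: (good_square (i := r) (j := j) (i2 := r) (j2 := k) gY); rewrite ?b ?e //; lia.
have l1 := good_row gY b Ec.
have l2 : cell_lt s c (Some (s + 1)%R).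
  by apply: (good_lt gY (leqnn r) (ltnW lt) _ Ec e); case; lia.
by case: c Ec l1 l2 => [c|] //= _; lia.
Qed.

Section StepFacts.
Context (s : int) (Y : fill) (gY : good s Y).
Let Y1 := step s Y.

Lemma step_ghost_above r j : Y1 r.+1 j = bullet -> Y1 r j = entry s ->
  Y r j = bullet /\ Y r.+1 j = entry s.
Proof.
move=> b a; have Eb : Y r j = bullet.
  have [e|[]|[]] // := step_s_cases gY a.
  have [[b1 _ _]|[? _ [e1 _]]|[? _ [e1 _]]] := step_bullet_cases gY b.
  - by have /= := good_col gY e b1; lia.
  - by have /= := good_col gY e e1; lia.
  - by have /= := good_col gY e e1; lia.
split=> //; have [[b1 _ _]|[? _ []]|[? _ []]] // := step_bullet_cases gY b.
by have := good_col gY Eb b1.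
Qed.

Lemma s_kept r : has_entry Y r s -> has_entry Y1 r s \/ ghost_entry Y1 r s.
Proof.
move=> [c Ec]; have [[c1 Ec1 b]|nleft] := pselect (exists2 c1, c = c1.+1 & Y r c1 = bullet).
  by subst c; left; exists c1; have [] := step_bullet_to_s gY (leqnn r) (leqnSn c1) b Ec.
have [[r1 Er1 b]|nup] := pselect (exists2 r1, r = r1.+1 & Y r1 c = bullet).
  subst r; right; exists r1, c.
  by have [] := step_bullet_to_s gY (leqnSn r1) (leqnn c) b Ec.
left; exists c; apply: step_s_stay => // [c1|r1] E b.
- by apply: nleft; exists c1.
- by apply: nup; exists r1.
Qed.

(** The bullet moves one box right, under an entry lying above [s - 1] and at most [s], hence equal
    to [s]. The ghost of [s - 1] thus becomes a ghost of [s], the source of the braid relation. *)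
Lemma ghost_braid r : has_entry Y r s -> ghost_entry Y r (s - 1)%R ->
  has_entry Y1 r s /\ ghost_entry Y1 r s.
Proof.
move=> [c Ec] [i [j [Er b a]]]; subst r.
have E := good_row_bullet_s gY b Ec; subst c.
have [s1 b1] := step_bullet_to_s gY (leqnn _) (leqnSn j) b Ec.
split; first by exists j.
have [w Ew ?] := step_above_right gY b Ec a.
by exists i, j.+1; split => //; rewrite /Y1 Ew; congr (entry _); lia.
Qed.

Lemma ghost_back i : ghost_entry Y1 i.+1 s -> has_entry Y i (s - 1)%R ->
  ghost_entry Y i.+1 (s - 1)%R.
Proof.
move=> [_ [j [[<-] b a]]] [k Ek].
have [b1 e1] := step_ghost_above b a.
have E := good_adj_pred gY b1 Ek; subst j.
exists i, k; split => //.
have [c Ec] : exists c, Y i.+1 k = Some c.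
  by apply: (good_square (i := i) (j := k) (i2 := i.+1) (j2 := k.+1) gY); rewrite ?Ek ?e1 //; lia.
have l1 := good_col gY Ek Ec; have l2 := good_row gY Ec e1.
by case: c Ec l1 l2 => [c|] //= _; lia.
Qed.

Lemma rises_no_s r : rises s Y r -> ~ has_entry Y r s.
Proof.
move=> [j [b _ ns]] [c Ec]; have E := good_row_bullet_s gY b Ec; subst c; exact: ns.
Qed.

Lemma rises_s r : rises s Y r -> has_entry Y1 r s.
Proof.
by move=> [j [b e _]]; exists j; have [] := step_bullet_to_s gY (leqnSn r) (leqnn j) b e.
Qed.

Lemma no_s_no_ghost r : ~ has_entry Y r s -> ~ ghost_entry Y1 r s.
Proof.
move=> ns [i [j [E b a]]]; subst r; have [_ e] := step_ghost_above b a.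
by apply: ns; exists j.
Qed.

Lemma no_s_step r : ~ has_entry Y r s -> ~ rises s Y r -> ~ has_entry Y1 r s.
Proof.
move=> ns nr [j Ej]; have [e|[b e]|[b e]] := step_s_cases gY Ej.
- by apply: ns; exists j.
- by apply: ns; exists j.+1.
- apply: nr; exists j; split => // e1; by apply: ns; exists j.+1.
Qed.

Lemma rises_below_s i : rises s Y i -> has_entry Y i.+1 s.
Proof. by move=> [j [_ e _]]; exists j. Qed.

(** An [s + 1] would be right of the rising [s]; the box above it, between the bullet and [s + 1],
    would hold [s], and the bullet would be filled from the right. *)
Lemma rises_below_succ i : rises s Y i -> ~ has_entry Y i.+1 (s + 1)%R.
Proof.
move=> [j [b e ns]] [k Ek]; have E := good_adj_succ gY e Ek; subst k.
have [c Ec] : exists c, Y i j.+1 = Some c.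
  by apply: (good_square (i := i) (j := j) (i2 := i.+1) (j2 := j.+1) gY); rewrite ?b ?Ek //; lia.
have l1 := good_row gY b Ec; have l2 := good_col gY Ec Ek.
case: c Ec l1 l2 => [c|] //= Ec l1 l2.
by apply: ns; rewrite Ec; congr (entry _); lia.
Qed.

(** The box below [s - 1] is left of the rising [s]; between [s - 1] and [s] there is room only for
    a bullet. *)
Lemma rises_below_pred i : rises s Y i -> has_entry Y i (s - 1)%R ->
  ghost_entry Y i.+1 (s - 1)%R.
Proof.
move=> [j [b e ns]] [k Ek]; have E := good_adj_pred gY b Ek; subst j.
have [c Ec] : exists c, Y i.+1 k = Some c.
  by apply: (good_square (i := i) (j := k) (i2 := i.+1) (j2 := k.+1) gY); rewrite ?Ek ?e //; lia.
have l1 := good_col gY Ek Ec; have l2 := good_row gY Ec e.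
by case: c Ec l1 l2 => [c|] //= Ec; [lia|exists i, k].
Qed.

End StepFacts.

(* The operator of stage [r] of a partially slid tableau: the small entries of
   row [r - 1], the ghost of the last slid value if row [r] has a bullet below
   it, the entries of row [r] that have not been moved, and finally the last
   slid value of row [r - 1].  The argument [L r], [g r], [H r], [k r] list them. *)
Definition stage (u : int) (L : nat -> seq int) (g : nat -> bool)
    (H : nat -> sites -> sites) (k : nat -> bool) (r : nat) : sites -> sites :=
  (if r is i.+1 then actw (L i) else id) ** rep (g r) (act u) ** H r **
  (if r is i.+1 then rep (k i) (act u) else id).

Fixpoint stages (st : nat -> sites -> sites) (r : nat) : sites -> sites :=
  if r is r'.+1 then st r ** stages st r' else st 0.

Lemma stagesS st r : stages st r.+1 = st r.+1 ** stages st r.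
Proof. by []. Qed.

Section SwapWord.
Context (s : int) (Y : fill) (gY : good s Y) (tp : bool) (L H : nat -> seq int).
Context (Lfar : forall i z, z \in L i -> (z + 2 <= s)%R).
Context (Hfar : forall r z, z \in H r -> (s + 1 <= z)%R).
Context (Hin : forall r, (s + 1)%R \in H r -> has_entry Y r (s + 1)%R).
Let Y1 := step s Y.
Let a := act (s - 1)%R.
Let b := act s.
(** The flag [tp] tells whether [s - 1] belongs to the window of values read. It is false before the
    first swap of a window. *)
Let rho i := tp && `[< has_entry Y i (s - 1)%R >].
Let gh r := tp && `[< ghost_entry Y r (s - 1)%R >].
Let sg r := `[< has_entry Y r s >].
Let sg1 r := `[< has_entry Y1 r s >].
Let gh1 r := `[< ghost_entry Y1 r s >].
Let ri r := `[< rises s Y r >].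
Let before := stage (s - 1)%R L gh (fun r => rep (sg r) b ** actw (H r)) rho.
Let after := stage s (fun i => L i ++ nseq (rho i) (s - 1)%R) gh1 (fun r => actw (H r)) sg1.

Lemma braid_pred : a ** b ** a = b ** a ** b.
Proof. by have := act_braid (s - 1)%R; rewrite subrK. Qed.

Lemma pred_comm_high r c : rep c a ** actw (H r) = actw (H r) ** rep c a.
Proof.
by rewrite actw_comm_rep // => z /Hfar; lia.
Qed.

Lemma swap_comm_low i c : rep c b ** actw (L i) = actw (L i) ** rep c b.
Proof.
by rewrite actw_comm_rep // => z /Lfar; lia.
Qed.

(* What remains of stage [r + 1] once the letters common to both sides and
   commuting with [s] are removed; the case with a ghost is the braid relation. *)
Lemma swap_local r : rep (ri r.+1) b ** rep (gh r.+1) a ** rep (sg r.+1) b ** rep (rho r) a =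
  rep (sg1 r.+1) b ** rep (rho r) a ** rep (gh1 r.+1) b.
Proof.
have F1 : sg r.+1 -> sg1 r.+1 || gh1 r.+1.
  by move/asboolP/(s_kept gY) => [] /asboolP h; apply/orP; [left|right].
have F2 : sg r.+1 -> gh r.+1 -> sg1 r.+1 && gh1 r.+1.
  move/asboolP => h1 /andP[_ /asboolP h2]; have [? ?] := ghost_braid gY h1 h2.
  by apply/andP; split; apply/asboolP.
have F3 : gh1 r.+1 -> rho r -> gh r.+1.
  move/asboolP => h1 /andP[tp1 /asboolP h2]; rewrite /gh tp1 /=.
  by apply/asboolP; apply: ghost_back.
have F4 : ri r.+1 -> [&& ~~ sg r.+1, sg1 r.+1 & ~~ gh1 r.+1].
  move/asboolP => h; have h1 := rises_no_s gY h; apply/and3P; split.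
  - exact/asboolPn.
  - by apply/asboolP; apply: rises_s.
  - by apply/asboolPn; apply: no_s_no_ghost.
have F5 : ~~ sg r.+1 -> ~~ ri r.+1 -> ~~ sg1 r.+1 && ~~ gh1 r.+1.
  move=> /asboolPn h1 /asboolPn h2; apply/andP; split; apply/asboolPn.
  - exact: no_s_step.
  - exact: no_s_no_ghost.
have F6 : gh r.+1 -> rho r.
  move=> /andP[tp1 /asboolP[i [j [[<-] _ e]]]]; rewrite /rho tp1 /=.
  by apply/asboolP; exists j.
move: F1 F2 F3 F4 F5 F6.
(* The six facts rule out the inconsistent combinations; the remaining ones are trivial or follow
   from idempotence or from the braid relation. *)
case: (sg r.+1) (gh r.+1) (rho r) (sg1 r.+1) (gh1 r.+1) (ri r.+1)
  => [] [] [] [] [] [] //= F1 F2 F3 F4 F5 F6;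
  first [by have := F1 isT | by have := F2 isT isT | by have := F3 isT isT
   | by have := F4 isT | by have := F5 isT isT | by have := F6 isT | idtac];
  rewrite /rep ?op1f ?opf1 ?braid_pred /b /a ?act_idem //.
by rewrite -opA act_idem.
Qed.

(** Row [r + 1] already contains the letter [s], and no [s + 1] that would keep a second copy from
    moving back to it. If [s - 1] must be crossed, its ghost is present too and the braid relation
    applies. *)
Lemma rises_absorb r : ri r ->
  rep (gh r.+1) a ** rep (sg r.+1) b ** rep (rho r) a ** actw (H r.+1) ** b =
  rep (gh r.+1) a ** rep (sg r.+1) b ** rep (rho r) a ** actw (H r.+1).
Proof.
move=> /asboolP h.
have -> : sg r.+1 by apply/asboolP; exact: rises_below_s h.
have Hb : actw (H r.+1) ** b = b ** actw (H r.+1).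
  apply: actw_comm => z zH; have := Hfar zH.
  have [E|] := eqVneq z (s + 1)%R; last lia.
  by case: (rises_below_succ gY h); apply: Hin; rewrite -E.
rewrite -[_ ** actw _ ** b]opA Hb opA; congr (_ ** _).
have F : rho r -> gh r.+1.
  move=> /andP[tp1 /asboolP e]; rewrite /gh tp1 /=; apply/asboolP.
  exact: rises_below_pred.
case: (rho r) (gh r.+1) F => [] [] F //=; first last.
- by rewrite ?op1f ?opf1 act_idem.
- by rewrite ?op1f ?opf1 -opA act_idem.
- by have := F isT.
- by rewrite braid_pred -opA act_idem.
Qed.

Lemma before_stageE r : before r.+1 = actw (L r) **
  (rep (gh r.+1) a ** rep (sg r.+1) b ** rep (rho r) a ** actw (H r.+1)).
Proof. by rewrite /before /stage -!opA pred_comm_high. Qed.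

(** The outer factors carry the induction. After the swap, the [s] of row [r] is read at stage
    [r + 1], so [stages after r] lacks it. On the other side, an [s] rising into row [r] is still
    read in row [r + 1]; its extra copy is supplied by [rises_absorb]. *)
Lemma swap_stages r :
  rep (ri r) b ** stages before r = rep (sg1 r) b ** stages after r.
Proof.
elim: r => [|r IH].
  rewrite /= /before /after /stage !op1f !opf1 /=.
  have -> : gh 0 = false.
    by apply/negbTE; rewrite negb_and; apply/orP; right; apply/asboolPn => -[? [? []]].
  have gh10 : ~ ghost_entry Y1 0 s by case=> ? [? []].
  have -> : gh1 0 = false by apply/negbTE/asboolPn.
  rewrite !op1f !opA; congr (_ ** _).
  case: (boolP (ri 0)) => [/asboolP h|/asboolPn h].
    have -> : sg 0 = false by apply/negbTE/asboolPn; apply: rises_no_s h.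
    have -> : sg1 0 by apply/asboolP; apply: rises_s.
    by rewrite /= opf1.
  case: (boolP (sg 0)) => [/asboolP h1|/asboolPn h1].
    have -> : sg1 0 by apply/asboolP; case: (s_kept gY h1) => // /gh10.
    by rewrite op1f.
  have -> : sg1 0 = false by apply/negbTE/asboolPn; apply: no_s_step.
  by rewrite op1f.
have absorb : before r.+1 ** stages before r =
    before r.+1 ** (rep (ri r) b ** stages before r).
  case: (boolP (ri r)) => h; last by rewrite /= op1f.
  by rewrite opA -/b; congr (_ ** _); change (rep true b) with b; rewrite before_stageE -(opA (actw (L r))) rises_absorb.
rewrite !stagesS absorb IH !opA; congr (_ ** _).
rewrite -/a -/b actw_cat.
have -> : actw (nseq (rho r) (s - 1)%R) = rep (rho r) a.
  by case: (rho r); rewrite /= ?opf1.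
rewrite !opA !swap_comm_low -(opA _ (actw (H _)) (rep (rho r) _)) -pred_comm_high !opA.
congr (_ ** _ ** _); rewrite -!opA; congr (_ ** _); rewrite !opA; exact: swap_local.
Qed.

End SwapWord.

(** * Reading words and their invariance under a sequence of swaps *)

Definition letters (P : int -> Prop) (x : int) (n : nat) : seq int :=
  [seq z <- [seq (x + t%:Z)%R | t <- iota 0 n] | `[< P z >]].

Lemma mem_letters P x n z :
  (z \in letters P x n) = [&& (x <= z)%R, (z < x + n%:Z)%R & `[< P z >]].
Proof.
rewrite mem_filter andbC andbA; congr (_ && _); apply/mapP/andP.
  by move=> [t]; rewrite mem_iota => ? ->; lia.
by move=> [h1 h2]; exists `|z - x|%N; rewrite ?mem_iota; lia.
Qed.

Lemma sorted_letters P x n : sorted <%R (letters P x n).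
Proof.
apply: sorted_filter; first exact: lt_trans.
rewrite sorted_map; apply: sub_sorted (iota_ltn_sorted 0 n) => i j /=; lia.
Qed.

Lemma eq_letters P Q x n :
  (forall t, t < n -> P (x + t%:Z)%R <-> Q (x + t%:Z)%R) -> letters P x n = letters Q x n.
Proof.
move=> E; apply: eq_in_filter => z /mapP[t]; rewrite mem_iota => tn ->.
by apply: asbool_equiv_eq; apply: E; lia.
Qed.

Lemma letters_cat P x m n :
  letters P x (m + n) = letters P x m ++ letters P (x + m%:Z)%R n.
Proof.
rewrite /letters iotaD map_cat filter_cat; congr (_ ++ filter _ _).
rewrite add0n -[m in iota m n]addn0 iotaDl -map_comp; apply: eq_map => t /=; lia.
Qed.

Lemma letters1 P x : letters P x 1 = nseq `[< P x >] x.
Proof. by rewrite /letters /= addr0; case: ifP => // ->. Qed.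

Lemma letters_head P x n :
  letters P x n.+1 = nseq `[< P x >] x ++ letters P (x + 1)%R n.
Proof. by rewrite -add1n letters_cat letters1. Qed.

Lemma letters_last P x n :
  letters P x n.+1 = letters P x n ++ nseq `[< P (x + n%:Z)%R >] (x + n%:Z)%R.
Proof. by rewrite -addn1 letters_cat letters1. Qed.

Lemma letters_none P x n : (forall v, ~ P v) -> letters P x n = [::].
Proof.
move=> H; rewrite /letters; elim: [seq _ | _ <- _] => //= z w ->.
by case: ifP => // /asboolP /H.
Qed.

Fixpoint word (f : nat -> seq int) (N : nat) : seq int :=
  if N is N'.+1 then f N' ++ word f N' else [::].

Definition row_word (R : nat -> int -> Prop) (x : int) (n i : nat) : seq int :=
  letters (R i) x n.

Lemma eq_word f g N : (forall i, i < N -> f i = g i) -> word f N = word g N.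
Proof.
elim: N => //= N IH E; rewrite E // IH // => i iN; apply: E; lia.
Qed.

Lemma eq_stages st st1 N : (forall i, i <= N -> st i = st1 i) -> stages st N = stages st1 N.
Proof.
elim: N => [|N IH] E /=; first exact: E.
by rewrite E // IH // => i iN; apply: E; lia.
Qed.

Lemma stages_word f N : stages (fun r => actw (f r)) N = actw (word f N.+1).
Proof.
elim: N => [|N IH]; first by rewrite /= cats0.
by rewrite stagesS IH -actw_cat.
Qed.

Lemma actw_nseq (b : bool) l : actw (nseq b l) = rep b (act l).
Proof. by case: b; rewrite /= ?opf1. Qed.

Definition empty_below (N : nat) (Y : fill) := forall i v, N <= i -> ~ has_entry Y i v.

Lemma empty_below_step s Y N : good s Y -> empty_below N Y -> empty_below N (step s Y).
Proof.
move=> gY E i v Ni [j e]; have [ev|ne] := eqVneq v s; last first.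
  by apply: (E i v Ni); exists j; move: e; rewrite step_other //; apply/eqP.
subst v; have [h|[_ h]|[_ h]] := step_s_cases gY e.
- by apply: (E i s Ni); exists j.
- by apply: (E i s Ni); exists j.+1.
- by apply: (E i.+1 s); [lia|exists j].
Qed.

Lemma slide_seq_empty_below x Y N t : slide_seq x Y -> empty_below N (Y 0) ->
  empty_below N (Y t).
Proof.
move=> sq E; elim: t => // t IH; have [_ st] := sq; rewrite st.
by apply: empty_below_step => //; exact: slide_seq_good.
Qed.

(** After [t] swaps the last slid value is [x + t - 1]: the [t - 1] smaller values of the window are
    settled and [n - t] values are yet to move. The tests [0 < t] discard the value [x - 1], which
    is outside the window. *)
Definition state_op (x : int) (n : nat) (Y : nat -> fill) (N t : nat) : sites -> sites :=
  stages (stage (x + t%:Z - 1)%R (fun i => letters (has_entry (Y t) i) x t.-1)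
    (fun r => (0 < t) && `[< ghost_entry (Y t) r (x + t%:Z - 1)%R >])
    (fun r => actw (letters (has_entry (Y t) r) (x + t%:Z)%R (n - t)))
    (fun i => (0 < t) && `[< has_entry (Y t) i (x + t%:Z - 1)%R >])) N.

Lemma state_op_step x n Y N t : slide_seq x Y -> empty_below N (Y 0) -> t < n ->
  state_op x n Y N t = state_op x n Y N t.+1.
Proof.
move=> sq E tn; have gY := slide_seq_good t sq.
have [_ st] := sq; have Et := slide_seq_empty_below (t := t) sq E.
pose H r := letters (has_entry (Y t) r) (x + t%:Z + 1)%R (n - t.+1).
pose L i := letters (has_entry (Y t) i) x t.-1.
have Lfar i z : z \in L i -> (z + 2 <= x + t%:Z)%R by rewrite mem_letters; lia.
have Hfar r z : z \in H r -> (x + t%:Z + 1 <= z)%R by rewrite mem_letters; lia.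
have Hin r : (x + t%:Z + 1)%R \in H r -> has_entry (Y t) r (x + t%:Z + 1)%R.
  by rewrite mem_letters => /and3P[_ _ /asboolP].
have := swap_stages gY (0 < t) Lfar Hfar Hin N.
(* There is no [s] in row [N] or below, so both outer factors of [swap_stages] are trivial. *)
have -> : `[< rises (x + t%:Z)%R (Y t) N >] = false.
  by apply/asboolPn => -[j [_ e _]]; apply: (Et N.+1 (x + t%:Z)%R); [lia|exists j].
have -> : `[< has_entry (step (x + t%:Z)%R (Y t)) N (x + t%:Z)%R >] = false.
  by apply/asboolPn; apply: (empty_below_step gY Et).
rewrite !op1f => h; rewrite /state_op.
transitivity (stages (stage (x + t%:Z - 1) L
        (fun r : nat => (0 < t)%N && `[< ghost_entry (Y t) r (x + t%:Z - 1) >])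
        (fun r : nat =>
         rep `[< has_entry (Y t) r (x + t%:Z) >] (act (x + t%:Z)) ** actw (H r))
        (fun i : nat => (0 < t)%N && `[< has_entry (Y t) i (x + t%:Z - 1) >])) N)%R.
  apply: eq_stages => r _; rewrite /stage; congr (_ ** _ ** _).
  have -> : (n - t = (n - t.+1).+1)%N by lia.
  by rewrite letters_head actw_cat actw_nseq.
rewrite h; apply: eq_stages => r _; rewrite /stage.
have -> : (x + t.+1%:Z - 1 = x + t%:Z)%R by lia.
rewrite st /=; congr (_ ** _ ** _ ** _).
- case: r => [//|i]; congr actw; rewrite -/(L i).
  case: t @L tn @H gY st Et Lfar Hfar Hin h => [|t] L tn H gY _ _ _ _ _ _ //=.
  rewrite letters_last; have -> : (x + t.+1%:Z - 1 = x + t%:Z)%R by lia.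
  congr (_ ++ _).
    by apply: eq_letters => u ut; rewrite has_entry_step //; lia.
  by congr (nseq _ _); congr nat_of_bool; apply: asbool_equiv_eq; rewrite has_entry_step //; lia.
- congr actw; rewrite /H; have -> : (x + t.+1%:Z = x + t%:Z + 1)%R by lia.
  by apply: eq_letters => u _; rewrite has_entry_step //; lia.
Qed.

(** At time 0 the stages are the rows. At time [n] nothing is left to move, so each ghost letter
    stands next to the same letter of the row above and is absorbed by idempotence. *)
Lemma slide_seq_word x Y N n : slide_seq x Y -> empty_below N (Y 0) ->
  actw (word (row_word (has_entry (Y 0)) x n) N) =
  actw (word (row_word (has_entry (Y n)) x n) N).
Proof.
move=> sq E; case: n => [|n].
  by congr actw; apply: eq_word.
have H t : t <= n.+1 -> state_op x n.+1 Y N t = state_op x n.+1 Y N 0.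
  by elim: t => // t IH tn; rewrite -state_op_step // IH //; lia.
have {}H := H n.+1 (leqnn _).
have -> : actw (word (row_word (has_entry (Y 0)) x n.+1) N) = state_op x n.+1 Y N 0.
  (* An empty row is added because moved entries of row [r] are read at stage [r + 1]: [N] rows need
     the stages [0, ..., N]. *)
  transitivity (actw (word (row_word (has_entry (Y 0)) x n.+1) N.+1)).
    by rewrite /= /row_word letters_none // => v; apply: E.
  rewrite -stages_word; apply: eq_stages => r _.
  by rewrite /stage /= addr0 subn0; case: r => [|r]; rewrite /= ?op1f ?opf1.
rewrite -H; set W := word _ N.
have -> : W = word (fun r => if r is i.+1 then row_word (has_entry (Y n.+1)) x n.+1 i else [::]) N.+1.
  rewrite /W {W H E}; elim: N => [//|N /= ->] //.
rewrite -stages_word; apply: eq_stages => r _; rewrite /stage subnn /=.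
have -> : (x + n.+1%:Z - 1 = x + n%:Z)%R by lia.
case: r => [|i].
  have -> : `[< ghost_entry (Y n.+1) 0 (x + n%:Z) >]%R = false.
    by apply/asboolPn => -[? [? []]].
  by rewrite /= ?op1f.
rewrite /row_word letters_last actw_cat actw_nseq -!opA; congr (_ ** _).
case: (boolP `[< ghost_entry _ _ _ >]) => [/asboolP[_ [j [[<-] _ e]]]|_] /=; last by rewrite !op1f.
have -> : `[< has_entry (Y n.+1) i (x + n%:Z)%R >] by apply/asboolP; exists j.
by rewrite /= op1f act_idem.
Qed.

(** * Moving a block of particles *)

Lemma actw_cons l w S : actw (l :: w) S = actw w (act l S).
Proof. by rewrite /= opE. Qed.

Lemma actw_catE u w S : actw (u ++ w) S = actw w (actw u S).
Proof. by rewrite actw_cat opE. Qed.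

Lemma act_keep l (S : sites) z : l <> z -> S z -> act l S z.
Proof.
move=> lz Sz; rewrite /act; case: eqP => [E|_]; first by case: lz.
by case: eqP => [<-|_]; rewrite ?Sz ?orbT.
Qed.

Lemma act_keep_empty l (S : sites) z : (l + 1)%R <> z -> ~~ S z -> ~~ act l S z.
Proof.
move=> lz Sz; rewrite /act; case: eqP => [<-|_]; first by rewrite negb_and Sz.
by case: eqP => [E|_] //; case: lz.
Qed.

Lemma act_move l (S : sites) : S l -> act l S (l + 1)%R.
Proof.
by move=> Sl; rewrite /act eqxx Sl; have -> : (l + 1 == l)%R = false by lia.
Qed.

Lemma actw_keep w (S : sites) z : z \notin w -> S z -> actw w S z.
Proof.
elim: w S => [//|l w IH] S; rewrite inE negb_or actw_cons => /andP[/eqP zl zw] Sz.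
by apply: IH => //; apply: act_keep => // E; apply: zl.
Qed.

Lemma actw_keep_empty w (S : sites) z : (z - 1)%R \notin w -> ~~ S z -> ~~ actw w S z.
Proof.
elim: w S => [//|l w IH] S; rewrite inE negb_or actw_cons => /andP[/eqP zl zw] Sz.
by apply: IH => //; apply: act_keep_empty => // E; apply: zl; lia.
Qed.

Lemma actw_empty_above w (S : sites) m : (forall l, l \in w -> (m < l)%R) ->
  (forall z, (m < z)%R -> ~~ S z) -> forall z, (m < z)%R -> ~~ actw w S z.
Proof.
elim: w S => [//|l w IH] S lw ES z mz; rewrite actw_cons.
have ml : (m < l)%R by apply: lw; rewrite inE eqxx.
apply: IH => // [l1 h|z1 h]; first by apply: lw; rewrite inE h orbT.
rewrite /act (negbTE (ES _ ml)) (negbTE (ES z1 h)).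
by case: ifP => // _; case: ifP => // _; apply: ES; lia.
Qed.

Lemma sorted_cons_lt (l : int) w z : sorted <%R (l :: w) -> z \in w -> (l < z)%R.
Proof.
move=> sw zw; have := order_path_min lt_trans sw; by move/allP/(_ _ zw).
Qed.

(** A particle enters the empty site [z] by the letter [z - 1], which leaves site [z - 1] empty.
    Only the letter [z - 2] could refill it, and it cannot come later in an increasing word. *)
Lemma actw_hole w (S : sites) z : sorted <%R w -> ~~ S z -> actw w S z ->
  ~~ actw w S (z - 1)%R.
Proof.
elim: w S => [|l w IH] S sw Sz; first by rewrite /= (negbTE Sz).
have sw' := path_sorted sw; rewrite !actw_cons.
have [El|nl] := eqVneq (l + 1)%R z.
  move=> _; apply: actw_keep_empty.
    by apply/negP => /(sorted_cons_lt sw); lia.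
  have -> : (z - 1 = l)%R by lia.
  by rewrite /act eqxx El (negbTE Sz) andbF.
by apply: IH => //; apply: act_keep_empty => //; apply/eqP.
Qed.

(* A particle at [lo] that meets the letters [lo, ..., y - 1] in increasing order
   reaches site [y], possibly by pushing others. *)
Lemma actw_run w (S : sites) lo y e : sorted <%R w -> S lo -> (lo <= y <= e)%R ->
  (forall z, (lo <= z < y)%R -> z \in w) ->
  (forall z, (y < z <= e)%R -> S z) -> (forall l, l \in w -> (l < e)%R) ->
  forall z, (y <= z <= e)%R -> actw w S z.
Proof.
elim: w S lo => [|l w IH] S lo sw Slo le run full lt z Hz.
  have Ey : y = lo by case: (eqVneq y lo) => // ne; have := run lo ltac:(lia).
  by case: (eqVneq z y) => [->|ne]; [rewrite Ey|apply: full; lia].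
have sw' := path_sorted sw; rewrite actw_cons.
have lt' l1 : l1 \in w -> (l1 < e)%R by move=> h; apply: lt; rewrite inE h orbT.
have le_e : (l < e)%R by apply: lt; rewrite inE eqxx.
have run' z1 : (lo <= z1 < y)%R -> z1 <> l -> z1 \in w.
  by move=> /run; rewrite inE => /orP[/eqP|].
case: (ltP l lo) => llo.
  apply: (IH _ lo) => //; first by apply: act_keep; lia.
    by move=> z1 h; apply: run' => //; lia.
  by move=> z1 h; apply: act_keep; [lia|apply: full].
case: (ltP lo y) => loy.
  have El : l = lo.
    have := run lo ltac:(lia); rewrite inE => /orP[/eqP//|/(sorted_cons_lt sw)]; lia.
  subst l; apply: (IH _ (lo + 1)%R) => //; [exact: act_move|lia| |].
    by move=> z1 h; apply: run'; lia.
  by move=> z1 h; apply: act_keep; [lia|apply: full].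
have Ey : y = lo by lia.
have keep z1 : (y <= z1 <= e)%R -> act l S z1.
  have S1 z2 : (y <= z2 <= e)%R -> S z2.
    by move=> h; case: (eqVneq z2 y) => [->|ne]; [rewrite Ey|apply: full; lia].
  move=> h; have [E|ne] := eqVneq l z1; last by apply: act_keep; [apply/eqP|apply: S1].
  by subst z1; rewrite /act eqxx !S1 //; lia.
apply: (IH _ lo) => //; first by apply: keep; lia.
  by move=> z1; lia.
by move=> z1 h; apply: keep; lia.
Qed.

Lemma mem_word f n l : l \in word f n -> exists2 i, i < n & l \in f i.
Proof.
elim: n => //= n IH; rewrite mem_cat => /orP[h|/IH[i ? ?]]; first by exists n.
by exists i => //; lia.
Qed.

Lemma word_add f m n : word f (m + n) = word (fun i => f (m + i)) n ++ word f m.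
Proof. by elim: n => [|n IH]; rewrite ?addn0 // addnS /= IH catA. Qed.

(** By [actw_hole], one row can fill a hole of a full block only at its left end, so each row
    extends the block by at most one site. *)
Lemma block_back f v (S : sites) i y : (forall r, sorted <%R (f r)) ->
  (forall z, (y <= z <= v)%R -> actw (word f i) S z) ->
  forall z, (y + i%:Z <= z <= v)%R -> S z.
Proof.
move=> sf; elim: i S => [|i IH] S H z Hz; first by apply: H; lia.
have H1 : forall z, (y + i%:Z <= z <= v)%R -> actw (f i) S z.
  by apply: IH => z1 /H; rewrite /= actw_catE.
apply/negP => /negP nS; have := actw_hole (sf i) nS (H1 _ _); move=> /(_ ltac:(lia)).
by rewrite H1 //; lia.
Qed.

(** The rows [>= b] act first. Those of index [>= v - c] have letters beyond all the particles and
    move nothing; the others lack the letter [v]. Hence site [v + 1] is still empty when the top [b]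
    rows begin, whereas [block_back] would require it to be full. *)
Lemma block_not_full f (b c v n : nat) : (forall r, sorted <%R (f r)) ->
  (forall i l, l \in f i -> (i%:Z + 1 <= l)%R) ->
  (forall i l, b <= i -> l \in f i -> (l <= i%:Z + c%:Z)%R) ->
  b <= n -> c <= v ->
  ~ (forall z, (v%:Z + 1 - b%:Z <= z <= v%:Z + 1)%R ->
       actw (word f n) (fun z => z <= v%:Z - c%:Z)%R z).
Proof.
move=> sf lo hi bn cv H; pose d := n - b.
have En : n = b + d by lia.
move: H; rewrite En word_add => H.
have main d1 (S : sites) : (forall z, (v%:Z - c%:Z < z)%R -> ~~ S z) ->
    ~~ actw (word (fun i => f (b + i)) d1) S (v%:Z + 1)%R.
  elim: d1 S => [|d1 IH] S ES; first by apply: ES; lia.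
  case: (leqP (v - c) (b + d1)) => h.
    rewrite /= actw_catE; apply: IH; apply: actw_empty_above => // l /lo; lia.
  apply: actw_keep_empty; last by apply: ES; lia.
  apply/negP => /mem_word[i id]; have -> : (v%:Z + 1 - 1 = v%:Z)%R by lia.
  by move/hi => /(_ ltac:(lia)); lia.
have /negP := main d (fun z => z <= v%:Z - c%:Z)%R ltac:(move=> z; lia); apply.
apply: (block_back (f := f) (v := (v%:Z + 1)%R) (i := b) (y := (v%:Z + 1 - b%:Z)%R)) => //; last lia.
by move=> z /H; rewrite actw_catE.
Qed.

(** Row [i] carries the particle at site [i + 1] all the way to the left end of the block; each of
    the top rows thus adds one site. *)
Lemma block_up f (b v : nat) : (forall r, sorted <%R (f r)) ->
  (forall i l, l \in f i -> (i%:Z + 1 <= l <= v%:Z)%R) ->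
  (forall i z, i < b -> (i%:Z + 1 <= z <= v%:Z - b%:Z + i%:Z)%R -> z \in f i) ->
  b < v ->
  forall i (S : sites), i <= b -> (forall z, (1 <= z <= i%:Z)%R -> S z) ->
  (forall z, (v%:Z + 1 - b%:Z + i%:Z <= z <= v%:Z + 1)%R -> S z) ->
  forall z, (v%:Z + 1 - b%:Z <= z <= v%:Z + 1)%R -> actw (word f i) S z.
Proof.
move=> sf bd run bv; elim=> [|i IH] S ib S1 S2; first by move=> z h; apply: S2; lia.
move=> z h; rewrite /= actw_catE; apply: IH => //; first lia.
  move=> z1 h1; apply: actw_keep; last by apply: S1; lia.
  by apply/negP => /bd; lia.
apply: (actw_run (lo := (i%:Z + 1)%R)) => //; first by apply: S1; lia.
- by lia.
- by move=> z1 h1; apply: run => //; lia.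
- by move=> z1 h1; apply: S2; lia.
- by move=> l /bd; lia.
Qed.

(** Row [v - c - 1] carries a particle from site [v - c] to site [v], where it waits until row [b]
    sends it to [v + 1]. The [b] rows above then line up [b] further particles next to it. *)
Lemma block_full f (b c v n : nat) : (forall r, sorted <%R (f r)) ->
  (forall i l, l \in f i -> (i%:Z + 1 <= l <= v%:Z)%R) ->
  (forall i z, i < b -> (i%:Z + 1 <= z <= v%:Z - b%:Z + i%:Z)%R -> z \in f i) ->
  b + c < v -> v - c <= n ->
  (forall z, (v%:Z - c%:Z <= z < v%:Z)%R -> z \in f (v - c).-1) ->
  v%:Z%R \in f b -> (forall i, b < i < v - c -> v%:Z%R \notin f i) ->
  forall z, (v%:Z + 1 - b%:Z <= z <= v%:Z + 1)%R ->
    actw (word f n) (fun z => z <= v%:Z - c%:Z)%R z.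
Proof.
move=> sf bd run bcv vn top vb nov z Hz.
have En : n = (v - c) + (n - (v - c)) by lia.
rewrite En word_add actw_catE; set S := actw (word (fun i => f (v - c + i)) _) _.
have S0 z1 : (z1 <= v%:Z - c%:Z)%R -> S z1.
  move=> h; apply: actw_keep => //; apply/negP => /mem_word[i _ /bd]; lia.
have {}S0 : forall z1, (1 <= z1 <= (v - c)%:Z)%R -> S z1 by move=> z1 h; apply: S0; lia.
move: S S0 => {En vn n} S S0.
(* [lo] is the site of the travelling particle when row [b] begins: [v - c] if row [b] is itself row
   [v - c - 1], and [v] otherwise. *)
have [S1 [lo [-> H1 Hlo Hin]]] : exists S1 lo,
    [/\ actw (word f (v - c)) S = actw (word f b.+1) S1,
        forall z1, (1 <= z1 <= b%:Z)%R -> S1 z1,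
        S1 lo /\ (lo <= v%:Z)%R &
        forall z1, (lo <= z1 <= v%:Z)%R -> z1 \in f b].
  have [Eb|nb] := eqVneq (v - c) b.+1.
    exists S, b.+1%:Z%R; rewrite Eb; split => //.
    - by move=> z1 h; apply: S0; lia.
    - by split; [apply: S0|]; lia.
    - move=> z1 h; have [->//|ne] := eqVneq z1 v%:Z%R.
      by have := top z1 ltac:(lia); rewrite Eb.
  pose d := (v - c) - b.+2.
  have Ev : v - c = b.+1 + d.+1 by lia.
  exists (actw (word (fun i => f (b.+1 + i)) d.+1) S), v%:Z%R.
  rewrite Ev word_add actw_catE; split => //; last first.
  - by move=> z1 h; have -> : (z1 = v%:Z)%R by lia.
  - split; last lia.
    rewrite /= actw_catE; apply: actw_keep.
      by apply/negP => /mem_word[i id]; apply/negP; apply: nov; lia.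
    have Er : b.+1 + d = (v - c).-1 by lia.
    rewrite Er; apply: (actw_run (lo := (v%:Z - c%:Z)%R) (y := v%:Z%R) (e := v%:Z%R)) => //.
    + by apply: S0; lia.
    + by lia.
    + by move=> z1; lia.
    + move=> l hl; have := bd _ _ hl; have [E|ne] := eqVneq l v%:Z%R; last lia.
      by have := nov (v - c).-1 ltac:(lia); rewrite -E hl.
    + by lia.
  - move=> z1 h; apply: actw_keep; last by apply: S0; lia.
    by apply/negP => /mem_word[i _ /bd]; lia.
rewrite /= actw_catE; apply: (block_up sf bd run _ (leqnn b)) => //; first lia.
  move=> z1 h; apply: actw_keep; last exact: H1.
  by apply/negP => /bd; lia.
case: Hlo => Slo lov z1 h.
apply: (actw_run (lo := lo) (y := (v%:Z + 1)%R) (e := (v%:Z + 1)%R)) => //.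
- by lia.
- by move=> z2 h2; apply: Hin; lia.
- by move=> z2; lia.
- by move=> l /bd; lia.
- by lia.
Qed.

(** * Slides of finite maps as sequences of swaps *)

Local Open Scope fset_scope.
Local Open Scope fmap_scope.
Lemma box_leE (i j k l : nat) : (((i, j) : box) <= ((k, l) : box))%O = (i <= k) && (j <= l).
Proof. by rewrite leEprod /= !leEnat. Qed.

Lemma box_ltE (i j k l : nat) :
  (((i, j) : box) < ((k, l) : box))%O = [&& i <= k, j <= l & (i < k) || (j < l)].
Proof.
rewrite lt_neqAle box_leE /eq_op /=; lia.
Qed.

Definition tab (T : {fmap box -> int}) (i j : nat) : option int := T.[? ((i, j) : box)].

Definition fill_of (Y : {fmap box -> option int}) : fill :=
  fun i j => Y.[? ((i, j) : box)].

Lemma fnd_fmap (K : choiceType) V (A : {fset K}) (F : A -> V) k (kA : k \in A) :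
  [fmap x : A => F x].[? k] = Some (F [` kA]).
Proof. by rewrite (in_fnd (f := [fmap x : A => F x]) kA) ffunE. Qed.

Lemma tab_dom T i j : (((i, j) : box) \in domf T) = isSome (tab T i j).
Proof. by rewrite /tab fndSome. Qed.

Lemma tab_inj T1 T2 : (forall i j, tab T1 i j = tab T2 i j) -> T1 = T2.
Proof. by move=> E; apply/fmapP => -[i j]; exact: E. Qed.

Lemma tab_val T (x : domf T) : tab T (val x).1 (val x).2 = Some (T x).
Proof. by rewrite /tab -surjective_pairing Some_fnd. Qed.

Lemma tab_ex T i j v : tab T i j = Some v -> exists2 x : domf T, val x = (i, j) & T x = v.
Proof.
move=> E; have h : ((i, j) : box) \in domf T by rewrite tab_dom E.
by exists [` h] => //; move: E; rewrite /tab in_fnd => -[].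
Qed.

Lemma increasingP T : increasing T <->
  forall i j k l u v, i <= k -> j <= l -> (i, j) <> (k, l) ->
    tab T i j = Some u -> tab T k l = Some v -> (u < v)%R.
Proof.
split=> [inc i j k l u v ik jl ne /tab_ex[x Ex <-] /tab_ex[y Ey <-]|H x y].
  apply: inc; rewrite Ex Ey box_ltE ik jl /=.
  by case: (ltnP i k) => //= ki; case: (ltnP j l) => //= lj; case: ne; congr pair; lia.
rewrite (surjective_pairing (val x)) (surjective_pairing (val y)) box_ltE.
move=> /and3P[ik jl lt]; apply: (H _ _ _ _ _ _ ik jl _ (tab_val x) (tab_val y)).
by move=> [e1 e2]; move: lt; rewrite e1 e2 !ltnn.
Qed.

Lemma covers_row i j : covers (i, j) (i, j.+1).
Proof.
split; first by rewrite box_ltE; lia.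
by move=> [k l]; rewrite !box_ltE; lia.
Qed.

Lemma covers_col i j : covers (i, j) (i.+1, j).
Proof.
split; first by rewrite box_ltE; lia.
by move=> [k l]; rewrite !box_ltE; lia.
Qed.

Lemma coversP (x y : box) : covers x y ->
  (y = (x.1, x.2.+1) :> box) \/ (y = (x.1.+1, x.2) :> box).
Proof.
case: x y => [i j] [k l] [lt no] /=.
have := no (i, j.+1); have := no (i.+1, j); move: lt; rewrite !box_ltE => lt h1 h2.
by case: (eqVneq i k) => [E|ne]; [left; congr pair; lia|right; congr pair; lia].
Qed.

Lemma swap_fill s (Y : {fmap box -> option int}) :
  good s (fill_of Y) -> fill_of (swap (Some s) None Y) = step s (fill_of Y).
Proof.
move=> gY; apply/funext => i; apply/funext => j.
have hasP (c : option int) :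
    has_neighbor_valued Y (i, j) c <->
    [\/ fill_of Y i j.+1 = Some c, fill_of Y i.+1 j = Some c,
        exists2 j1, j = j1.+1 & fill_of Y i j1 = Some c
      | exists2 i1, i = i1.+1 & fill_of Y i1 j = Some c].
  split.
    move=> [[[k l] kl] /= nb e].
    have Ey : fill_of Y k l = Some c by rewrite /fill_of (in_fnd kl) -e.
    case: nb => /coversP[] /= [E1 E2]; subst.
    - by constructor 1.
    - by constructor 2.
    - by constructor 3; exists l.
    - by constructor 4; exists k.
  have mk k l : fill_of Y k l = Some c -> neighbor (i, j) (k, l) ->
      has_neighbor_valued Y (i, j) c.
    move=> E nb; have h : ((k, l) : box) \in domf Y by rewrite -fndSome; move: E; rewrite /fill_of => ->.
    by exists [` h] => //; move: E; rewrite /fill_of (in_fnd h) => -[].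
  case=> [e|e|[j1 E e]|[i1 E e]]; apply: mk e _.
  - by left; apply: covers_row.
  - by left; apply: covers_col.
  - by right; rewrite E; apply: covers_row.
  - by right; rewrite E; apply: covers_col.
rewrite {1}/fill_of /swap /step.
have [xY|xY] := boolP (((i, j) : box) \in domf Y); last first.
  by rewrite /fill_of !not_fnd.
rewrite (fnd_fmap _ xY).
have -> : fill_of Y i j = Some Y.[xY] by rewrite /fill_of (in_fnd xY).
have EY : fill_of Y i j = Some Y.[xY] by rewrite /fill_of (in_fnd xY).
move: (Y.[xY]) EY => y EY /=; case: y EY => [v|] EY /=.
  change (Some v == Some s) with (v == s).
  have [vs|//] /= := eqVneq v s; subst v.
  case: (asboolP (has_neighbor_valued Y (i, j) None)) => [/hasP h|h].
    case: ifP => // /negP[]; apply/orP.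
    case: h => [e|e|[j1 Ej e]|[i1 Ei e]]; [exfalso|exfalso|left|right].
    - by have := good_row gY EY e => /=; lia.
    - by have := good_col gY EY e => /=; lia.
    - by subst j; rewrite /= e.
    - by subst i; rewrite /= e.
  case: ifP => // /orP[]/andP[i0 /eqP e]; case: h; apply/hasP.
  - by constructor 3; exists j.-1 => //; lia.
  - by constructor 4; exists i.-1 => //; lia.
case: (asboolP (has_neighbor_valued Y (i, j) (Some s))) => [/hasP h|h] /=.
  case: ifP => // /negP[]; apply/orP.
  case: h => [e|e|[j1 Ej e]|[i1 Ei e]]; [left|right|exfalso|exfalso].
  - by rewrite e.
  - by rewrite e.
  - by subst j; have := good_row gY e EY => /=; lia.
  - by subst i; have := good_col gY e EY => /=; lia.
case: ifP => // /orP[]/eqP e; case: h; apply/hasP.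
- by constructor 1.
- by constructor 2.
Qed.

Definition init_fill (C : {fset box}) (T : {fmap box -> int}) : fill :=
  fun i j => if ((i, j) : box) \in C then bullet else omap Some (tab T i j).

Lemma add_bullets_fill C T : fill_of (add_bullets C T) = init_fill C T.
Proof.
apply/funext => i; apply/funext => j; rewrite /fill_of /add_bullets fnd_cat /init_fill /=.
have [h|h] := boolP (((i, j) : box) \in C); first by rewrite (fnd_fmap _ h).
have [kf|kf] := boolP (((i, j) : box) \in domf T).
  by rewrite (fnd_fmap _ kf) /tab (in_fnd kf).
by rewrite /tab !not_fnd.
Qed.

Lemma delete_bullets_fnd Y i j : tab (delete_bullets Y) i j = odflt None (fill_of Y i j).
Proof.
rewrite /tab /delete_bullets /fill_of.
have [h|h] := boolP (((i, j) : box) \in [fset y in domf Y | Y.[? y] != Some None]).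
  rewrite (fnd_fmap _ h) /=; move: h; rewrite !inE /= => /andP[h].
  by rewrite (in_fnd h); case: (Y.[h]).
rewrite not_fnd //; move: h; rewrite !inE /= negb_and negbK => /orP[h|/eqP ->//].
by rewrite not_fnd.
Qed.

Fixpoint run (p : int) (n : nat) (Y : fill) : fill :=
  if n is m.+1 then step (p + m%:Z)%R (run p m Y) else Y.

Lemma run_seq p Y : good p Y -> slide_seq p (fun t => run p t Y).
Proof. by []. Qed.

Lemma run_good p n Y : good p Y -> good (p + n%:Z)%R (run p n Y).
Proof. by move=> gY; apply: (slide_seq_good n (run_seq gY)). Qed.

Lemma step_id s Y : (forall i j, Y i j <> entry s) -> step s Y = Y.
Proof.
move=> ns; apply/funext => i; apply/funext => j; rewrite /step.
case E: (Y i j) => [[v|]|] //.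
  by case: eqVneq => //= vs; case: (ns i j); rewrite E vs.
by case: ifP => // /orP[]/eqP/ns.
Qed.

Lemma run_entry p n Y i j v : run p n Y i j = entry v ->
  exists k l, i <= k /\ Y k l = entry v.
Proof.
elim: n i j v => [|n IH] i j v /=; first by exists i, j.
rewrite /step; case E: (run p n Y i j) => [[u|]|] //.
  by case: ifP => // _ [<-]; apply: IH E.
case: ifP => // /orP[]/eqP e [<-]; first exact: IH e.
by have [k [l [ik ?]]] := IH _ _ _ e; exists k, l; split => //; lia.
Qed.

Lemma run_low p k n Y : (forall i j v, Y i j = entry v -> (p + k%:Z <= v)%R) ->
  run p (k + n) Y = run (p + k%:Z)%R n Y.
Proof.
move=> lo; elim: n => [|n IH].
  rewrite addn0 /=; elim: k lo => [//|k IH] lo /=.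
  rewrite IH; last by move=> i j v /lo; lia.
  by apply: step_id => i j /lo; lia.
by rewrite addnS /= IH; congr (step _ _); lia.
Qed.

Lemma run_high p k n Y : (forall i j v, Y i j = entry v -> (v < p + n%:Z)%R) ->
  run p (n + k) Y = run p n Y.
Proof.
move=> hi; elim: k => [|k IH]; first by rewrite addn0.
rewrite addnS /= IH; apply: step_id => i j /run_entry[k1 [l1 [_ /hi]]]; lia.
Qed.

(** Swaps with absent values do nothing, so both intervals can be compared with one that contains
    them. This makes a slide independent of the chosen interval. *)
Lemma run_indep p n p1 n1 Y :
  (forall i j v, Y i j = entry v -> (p <= v < p + n%:Z)%R) ->
  (forall i j v, Y i j = entry v -> (p1 <= v < p1 + n1%:Z)%R) ->
  run p n Y = run p1 n1 Y.
Proof.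
have main q m q1 m1 : (q1 <= q)%R -> (q + m%:Z <= q1 + m1%:Z)%R ->
    (forall i j v, Y i j = entry v -> (q <= v < q + m%:Z)%R) ->
    run q1 m1 Y = run q m Y.
  move=> le le1 H; set k := `|q - q1|%N.
  have -> : m1 = (k + (m + (m1 - k - m)))%N by lia.
  have E : (q1 + k%:Z = q)%R by lia.
  rewrite run_low E; first by apply: run_high => i j v /H; lia.
  by move=> i j v /H; lia.
move=> H H1.
pose q := Num.min p p1; pose m := `|Num.max (p + n%:Z)%R (p1 + n1%:Z)%R - q|%N.
by rewrite -(main p n q m) -?(main p1 n1 q m) //; lia.
Qed.

Definition slide_data (nu la C : {fset box}) (T : {fmap box -> int}) : Prop :=
  [/\ skew_presentation nu la (domf T), increasing T
    & forall x : box, x \in C -> maximal_box la x].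

Lemma init_good s nu la C T : slide_data nu la C T ->
  (forall i j v, tab T i j = Some v -> (s <= v)%R) -> good s (init_fill C T).
Proof.
move=> [[snu sla lanu ET] inc maxC] lo.
have inC x y : x \in la -> y \in C -> (y <= x)%O -> x = y.
  move=> xla /maxC[_ m]; rewrite le_eqVlt => /orP[/eqP//|/(m _ xla)//].
have domP i j : init_fill C T i j <> None <->
    ((i, j) : box) \in C \/ ((i, j) : box) \in domf T.
  rewrite /init_fill (tab_dom T); case: ifP => _; first by split => // _; left.
  case: (tab T i j) => [v|] /=; first by split => // _; right.
  by split => // -[].
split.
- move=> i j i1 j1 i2 j2 Hi Hj /domP h /domP h2; apply/domP.
  have le : (((i, j) : box) <= ((i1, j1) : box))%O by rewrite box_leE; lia.
  have le2 : (((i1, j1) : box) <= ((i2, j2) : box))%O by rewrite box_leE; lia.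
  have n1 : ((i1, j1) : box) \in nu.
    apply: (snu _ _ le2); case: h2 => [/maxC[h2 _]|]; first by apply: (fsubsetP lanu).
    by rewrite ET inE => /andP[].
  have [l1|l1] := boolP (((i1, j1) : box) \in la); last by right; rewrite ET inE l1 n1.
  left; case: h => [h|]; last by rewrite ET inE (sla _ _ le l1).
  by rewrite (inC _ _ l1 h le).
- move=> i j i1 j1 c c1 Hi Hj ne; rewrite /init_fill.
  have le : (((i, j) : box) <= ((i1, j1) : box))%O by rewrite box_leE; lia.
  case: ifP => [h [<-]|h].
    case: ifP => [h1|_]; first by case: ne; have /= := inC _ _ (proj1 (maxC _ h1)) h le => ->.
    by case E: (tab T i1 j1) => [v|] //= -[<-] /=; apply: lo E.
  case E: (tab T i j) => [u|] //= -[<-]; case: ifP => [h1|h1].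
    have := tab_dom T i j; rewrite E /= ET inE.
    by rewrite (sla _ _ le (proj1 (maxC _ h1))).
  case E1: (tab T i1 j1) => [v|] //= -[<-] /=.
  by move/increasingP: inc => inc; apply: inc Hi Hj ne E E1.
Qed.

Lemma init_entry C T i j v : init_fill C T i j = entry v -> tab T i j = Some v.
Proof.
by rewrite /init_fill; case: ifP => // _; case: (tab T i j) => //= u [->].
Qed.

Lemma jdt_run nu la C T p q p1 n : slide_data nu la C T ->
  (forall i j v, tab T i j = Some v -> (p <= v <= q)%R) ->
  (forall i j v, tab T i j = Some v -> (p1 <= v < p1 + n%:Z)%R) ->
  forall i j, tab (jdt p q C T) i j = odflt None (run p1 n (init_fill C T) i j).
Proof.
move=> sd pq pn i j; rewrite /jdt delete_bullets_fnd; congr odflt.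
pose N := if (p <= q)%R then `|q - p|%N.+1 else 0.
have -> : int_range p q = [seq (p + k%:Z)%R | k <- iota 0 N].
  by rewrite /int_range /N; case: ifP.
have g : good p (init_fill C T) by apply: (init_good sd) => ? ? ? /pq/andP[].
have H m : fill_of (foldl (fun Y s => swap (Some s) None Y) (add_bullets C T)
    [seq (p + k%:Z)%R | k <- iota 0 m]) = run p m (init_fill C T).
  elim: m => [|m IH]; first by rewrite add_bullets_fill.
  rewrite -addn1 iotaD map_cat foldl_cat /= add0n addn1 swap_fill IH //.
  exact: run_good.
rewrite H; congr (_ _ _); apply: run_indep => k l v /init_entry; last exact: pn.
by move=> /pq; rewrite /N; case: ifP; lia.
Qed.

Lemma tab_bounds T : exists p n, forall i j v, tab T i j = Some v -> (p <= v < p + n%:Z)%R.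
Proof.
pose m := (\max_(x : domf T) `|T x|%N).
exists (- m%:Z)%R, (m + m.+1)%N => i j v /tab_ex[x _ <-].
by have := leq_bigmax (F := fun x : domf T => `|T x|%N) x; rewrite -/m; lia.
Qed.

Lemma forward_slide_run T T1 : forward_slide T T1 -> exists nu la C,
  slide_data nu la C T /\
  forall p n, (forall i j v, tab T i j = Some v -> (p <= v < p + n%:Z)%R) ->
    forall i j, tab T1 i j = odflt None (run p n (init_fill C T) i j).
Proof.
move=> [nu [la [C [p [q [sp inc pq maxC ->]]]]]]; exists nu, la, C.
have sd : slide_data nu la C T by [].
split => // p1 n H; apply: (jdt_run sd) => // i j v /tab_ex[x _ <-]; exact: pq.
Qed.

(** Entries [v] move only in the swap with [v]. So when the swaps of the window start, the entries
    [>= x] are where [T] has them, and when they end, those [< x + n] are where [T1] has them. The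
    second clause bounds the rows of [Y 0], whose smaller entries have already moved. *)
Lemma slide_window T T1 x n : forward_slide T T1 -> exists Y : nat -> fill,
  [/\ slide_seq x Y,
      forall i j v, Y 0 i j = entry v -> exists k l, i <= k /\ tab T k l = Some v,
      forall i j v, (x <= v)%R -> Y 0 i j = entry v <-> tab T i j = Some v
    & forall i j v, (v < x + n%:Z)%R -> Y n i j = entry v <-> tab T1 i j = Some v].
Proof.
move=> /forward_slide_run[nu [la [C [sd H]]]].
have [p0 [n0 b0]] := tab_bounds T.
pose p := Num.min p0 x; pose k := `|x - p|%N.
pose m := (k + n + n0 + `|p0 - p|)%N.
have b i j v : tab T i j = Some v -> (p <= v < p + m%:Z)%R by move/b0; lia.
have {H b0}H := H _ _ b.
have g : good p (init_fill C T) by apply: (init_good sd) => i j v /b; lia.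
have sq := run_seq g; have Ek : (p + k%:Z = x)%R by lia.
exists (fun t => run p (k + t) (init_fill C T)); split.
- split=> [|t]; first by rewrite addn0 -Ek; exact: run_good.
  by rewrite addnS /= -Ek; congr (step _ _); lia.
- by move=> i j v /run_entry[k1 [l1 [ik /init_entry E]]]; exists k1, l1.
- move=> i j v xv; rewrite addn0 (slide_seq_before _ _ sq) ?Ek //=.
  split; first exact: init_entry.
  move=> E; have := b _ _ _ E => _; rewrite /init_fill E /=; case: ifP => // h.
  case: sd => [[_ _ _ ET] _ maxC].
  by have := tab_dom T i j; rewrite E ET inE (proj1 (maxC _ h)).
- move=> i j v xv; rewrite H.
  rewrite -(slide_seq_after (t := k + n) (n := m) _ _ sq) /=; [|lia|lia].
  by case: (run _ _ _ _ _) => [[u|]|] //=; split=> // -[->].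
Qed.

(** * The two invariants for slides of tableaux *)

Definition row_has (T : {fmap box -> int}) (i : nat) (v : int) : Prop :=
  exists j, tab T i j = Some v.

Notation slides := (clos_refl_trans _ forward_slide).

Lemma slides_chain T T1 x m n : slides T T1 ->
  chain (row_has T) x m n 0 <-> chain (row_has T1) x m n 0.
Proof.
elim=> [A B|//|A B D _ -> _ ->] // {T T1}.
move=> /(slide_window x n)[Y [sq below h0 h1]].
have e0 : chain (row_has A) x m n 0 <-> chain (has_entry (Y 0)) x m n 0.
  by split; apply: chain_imp => t k tn _ [j E]; exists j; apply/h0 => //; lia.
have e1 : chain (row_has B) x m n 0 <-> chain (has_entry (Y n)) x m n 0.
  by split; apply: chain_imp => t k tn _ [j E]; exists j; apply/h1 => //; lia.
by rewrite e0 e1; apply: slide_seq_chain.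
Qed.

Lemma row_bound T : exists N, forall i j v, tab T i j = Some v -> i < N.
Proof.
exists (\max_(x : domf T) (val x).1).+1 => i j v /tab_ex[x Ex _].
by have := leq_bigmax (F := fun x : domf T => (val x).1) x; rewrite Ex ltnS.
Qed.

Lemma slides_word T T1 x n : slides T T1 -> exists N0, forall N, N0 <= N ->
  actw (word (row_word (row_has T) x n) N) = actw (word (row_word (row_has T1) x n) N).
Proof.
elim=> [A B|A|A B D _ [N1 IH1] _ [N2 IH2]] {T T1}; last first.
- by exists (maxn N1 N2) => N; rewrite geq_max => /andP[h1 h2]; rewrite IH1 // IH2.
- by exists 0.
move=> /(slide_window x n)[Y [sq below h0 h1]].
have [N0 bd] := row_bound A.
exists N0 => N le.
have e0 : word (row_word (row_has A) x n) N = word (row_word (has_entry (Y 0)) x n) N.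
  apply: eq_word => i _; apply: eq_letters => t tn.
  by split => -[j E]; exists j; apply/h0 => //; lia.
have e1 : word (row_word (row_has B) x n) N = word (row_word (has_entry (Y n)) x n) N.
  apply: eq_word => i _; apply: eq_letters => t tn.
  by split => -[j E]; exists j; apply/h1 => //; lia.
rewrite e0 e1.
apply: slide_seq_word => // i v Ni [j /below[k [l [ik /bd]]]]; lia.
Qed.

Definition make (A : {fset box}) (F : nat -> nat -> option int) : {fmap box -> int} :=
  [fmap x : [fset y in A | F y.1 y.2 != None] => odflt 0%R (F (val x).1 (val x).2)].

Lemma tab_make A F i j :
  tab (make A F) i j = if ((i, j) : box) \in A then F i j else None.
Proof.
rewrite /tab /make.
have [h|h] := boolP (((i, j) : box) \in [fset y in A | F y.1 y.2 != None]).
  rewrite (fnd_fmap _ h) /=; move: h; rewrite !inE /= => /andP[-> ].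
  by case: (F i j).
rewrite not_fnd //; move: h; rewrite !inE /=; case: ifP => //= _.
by rewrite negbK => /eqP.
Qed.

(** * Transposition *)

Definition flip (A : {fset box}) : {fset box} := [fset ((x.2, x.1) : box) | x in A].

Lemma mem_flip A i j : (((i, j) : box) \in flip A) = (((j, i) : box) \in A).
Proof.
apply/imfsetP/idP => /= [[[k l] h [-> ->]]|h] //.
by exists ((j, i) : box).
Qed.

Definition tr (T : {fmap box -> int}) : {fmap box -> int} :=
  make (flip (domf T)) (fun i j => tab T j i).

Lemma tab_tr T i j : tab (tr T) i j = tab T j i.
Proof.
rewrite tab_make mem_flip tab_dom; by case: (tab T j i).
Qed.

Lemma trK T : tr (tr T) = T.
Proof. by apply: tab_inj => i j; rewrite !tab_tr. Qed.

Lemma dom_tr T : domf (tr T) = flip (domf T).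
Proof. by apply/fsetP => -[i j]; rewrite mem_flip !tab_dom tab_tr. Qed.

Lemma straightP A : straight A <-> forall i j k l, i <= k -> j <= l ->
  ((k, l) : box) \in A -> ((i, j) : box) \in A.
Proof.
split=> [H i j k l ik jl|H [i j] [k l]].
  by apply: H; rewrite box_leE ik jl.
by rewrite box_leE => /andP[ik jl]; apply: H.
Qed.

Lemma straight_flip A : straight A -> straight (flip A).
Proof.
move=> /straightP sA; apply/straightP => i j k l ik jl; rewrite !mem_flip; exact: sA.
Qed.

Lemma increasing_tr T : increasing T -> increasing (tr T).
Proof.
move=> /increasingP H; apply/increasingP => i j k l u v ik jl ne.
by rewrite !tab_tr; apply: H => //; case=> *; apply: ne; congr pair.
Qed.

Lemma skew_flip nu la A : skew_presentation nu la A ->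
  skew_presentation (flip nu) (flip la) (flip A).
Proof.
move=> [snu sla /fsubsetP sub ->]; split; [exact: straight_flip|exact: straight_flip| |].
  by apply/fsubsetP => -[i j]; rewrite !mem_flip; apply: sub.
by apply/fsetP => -[i j]; rewrite !inE !mem_flip inE.
Qed.

Lemma step_flip s Y : step s (fun i j => Y j i) = fun i j => step s Y j i.
Proof.
apply/funext => i; apply/funext => j; rewrite /step.
by case: (Y j i) => [[v|]|] //; rewrite orbC.
Qed.

Lemma run_flip p n Y : run p n (fun i j => Y j i) = fun i j => run p n Y j i.
Proof. by elim: n => //= n ->; rewrite (step_flip _ (run p n Y)). Qed.

Lemma slide_data_flip nu la C T : slide_data nu la C T ->
  slide_data (flip nu) (flip la) (flip C) (tr T).
Proof.
move=> [sp inc maxC]; split; last move=> [i j].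
- by rewrite dom_tr; apply: skew_flip.
- exact: increasing_tr.
- rewrite mem_flip => /maxC[h m]; split; first by rewrite mem_flip.
  move=> [k l]; rewrite mem_flip => /m; rewrite !box_ltE; lia.
Qed.

Lemma forward_slide_tr T T1 : forward_slide T T1 -> forward_slide (tr T) (tr T1).
Proof.
move=> [nu [la [C [p [q [sp inc pq maxC ->]]]]]].
have sd : slide_data nu la C T by [].
have [sp1 inc1 maxC1] := slide_data_flip sd.
exists (flip nu), (flip la), (flip C), p, q; split => //.
  by move=> x; have := tab_val x; rewrite tab_tr => /tab_ex[y _ <-].
have [p0 [n0 b0]] := tab_bounds T.
have pq1 i j v : tab T i j = Some v -> (p <= v <= q)%R by move=> /tab_ex[x _ <-].
apply: tab_inj => i j; rewrite tab_tr (jdt_run sd pq1 b0).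
rewrite (jdt_run (slide_data_flip sd) (p1 := p0) (n := n0)); first last.
- by move=> k l v; rewrite tab_tr; apply: b0.
- by move=> k l v; rewrite tab_tr; apply: pq1.
have -> : init_fill (flip C) (tr T) = fun i j => init_fill C T j i.
  by apply/funext => k; apply/funext => l; rewrite /init_fill mem_flip tab_tr.
by rewrite (run_flip _ _ (init_fill C T)).
Qed.

Lemma slides_tr T T1 : slides T T1 -> slides (tr T) (tr T1).
Proof.
elim=> [A B /forward_slide_tr|A|A B D _ h1 _ h2]; [exact: rt_step|exact: rt_refl|].
exact: rt_trans h1 h2.
Qed.

Definition above (m : int) (T : {fmap box -> int}) : {fmap box -> int} :=
  make (domf T) (fun i j => if tab T i j is Some v then
                              if (m < v)%R then Some v else None else None).

Lemma tab_above m T i j v :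
  tab (above m T) i j = Some v <-> tab T i j = Some v /\ (m < v)%R.
Proof.
rewrite tab_make tab_dom; case: (tab T i j) => [u|] /=; last by split => // -[].
have [mu|mu] := boolP (m < u)%R.
  by split=> [E|[]//]; split=> //; case: E => <-.
by split=> // -[[E]]; rewrite -E (negbTE mu).
Qed.

Definition fill_above (m : int) (Y : fill) : fill := fun i j =>
  if Y i j is Some (Some v) then if (m < v)%R then entry v else None else Y i j.

Lemma fill_above_s m Y i j v : (m < v)%R ->
  (fill_above m Y i j == entry v) = (Y i j == entry v).
Proof.
move=> mv; rewrite /fill_above; case: (Y i j) => [[u|]|] //; case: ifP => // h.
by apply/esym/negbTE/eqP => -[E]; rewrite E mv in h.
Qed.

Lemma fill_above_bullet m Y i j : (fill_above m Y i j == bullet) = (Y i j == bullet).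
Proof. by rewrite /fill_above; case: (Y i j) => [[u|]|] //; case: ifP. Qed.

Lemma step_above m s Y : (m < s)%R -> step s (fill_above m Y) = fill_above m (step s Y).
Proof.
move=> ms; apply/funext => i; apply/funext => j.
rewrite {1}/step !fill_above_s // !fill_above_bullet /fill_above /step.
case: (Y i j) => [[v|]|] //.
- case: (ltP m v) => mv; first by case: ifP => //; rewrite mv.
  case: ifP => [/andP[/eqP E _]|_]; first by move: mv; rewrite E leNgt ms.
  by rewrite ltNge mv.
- by case: ifP => //; rewrite ms.
Qed.

Lemma run_above m p n Y : (m < p)%R -> run p n (fill_above m Y) = fill_above m (run p n Y).
Proof. by move=> mp; elim: n => //= n ->; rewrite step_above //; lia. Qed.

(** * Slides restricted to large values *)

Lemma increasing_above m T : increasing T -> increasing (above m T).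
Proof.
move=> /increasingP inc; apply/increasingP => i j k l u v ik jl ne.
by move=> /tab_above[e1 _] /tab_above[e2 _]; apply: inc ik jl ne e1 e2.
Qed.

Lemma dom_above m T x : x \in domf (above m T) -> x \in domf T.
Proof.
case: x => i j; rewrite !tab_dom; case E: (tab (above m T) i j) => [v|] // _.
by have [-> _] := (tab_above m T i j v).1 E.
Qed.

Lemma skew_above m T nu la : increasing T -> skew_presentation nu la (domf T) ->
  skew_presentation nu (nu `\` domf (above m T)) (domf (above m T)).
Proof.
move=> /increasingP inc [snu sla lanu ET]; split => //; first last.
- apply/fsetP => x; rewrite fsetDK //; apply/fsubsetP => y /dom_above.
  by rewrite ET inE => /andP[].
- exact: fsubsetDl.
apply/straightP => i j k l ik jl; rewrite !in_fsetD => /andP[h kl].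
have ij : ((i, j) : box) \in nu by move/straightP: snu => H; apply: H kl.
rewrite ij andbT; apply/negP => h1; case/negP: h.
have [[E1 E2]|ne] := pselect ((i, j) = (k, l)); first by rewrite -E1 -E2.
have kT : ((k, l) : box) \in domf T.
  rewrite ET inE kl andbT; apply/negP => kla.
  have := dom_above h1; rewrite ET inE.
  by move/straightP: sla => H; rewrite (H _ _ _ _ ik jl kla).
move: h1 kT; rewrite !tab_dom.
case E: (tab (above m T) i j) => [u|] // _; case E1: (tab T k l) => [v|] // _.
have [e mu] := (tab_above m T i j u).1 E.
have -> // : tab (above m T) k l = Some v.
by apply/tab_above; split => //; have := inc _ _ _ _ _ _ ik jl ne e E1; lia.
Qed.

(** Swaps with values [<= m] do not move larger entries. Once they are done, the remaining swaps
    form a slide of the large entries alone, started from the current positions of the bullets. *)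
Lemma forward_slide_above m T T1 : forward_slide T T1 ->
  forward_slide (above m T) (above m T1).
Proof.
move=> [nu [la [C [p [q [sp inc pq maxC ET1]]]]]].
have sd : slide_data nu la C T by [].
have [p0 [n0 b0]] := tab_bounds T.
have pq1 i j v : tab T i j = Some v -> (p <= v <= q)%R by move=> /tab_ex[x _ <-].
(* The run starts low enough for its first [k] swaps to end exactly with the value [m]. *)
pose lo := Num.min p0 (m + 1)%R; pose k := `|(m + 1 - lo)%R|%N.
pose n := (n0 + `|p0 - lo|)%N.
have Ek : (lo + k%:Z = m + 1)%R by lia.
have b i j v : tab T i j = Some v -> (lo <= v < lo + (k + n)%:Z)%R by move/b0; lia.
have ET i j : tab T1 i j = odflt None (run lo (k + n) (init_fill C T) i j).
  by rewrite ET1; apply: (jdt_run sd).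
have g : good lo (init_fill C T) by apply: (init_good sd) => i j v /b; lia.
have sq := run_seq g.
set Ym := run lo k (init_fill C T).
have gm : good (m + 1)%R Ym by rewrite -Ek; apply: run_good.
have [[snu sla lanu domT] _ _] := sd.
have initE i j v : init_fill C T i j = entry v <-> tab T i j = Some v.
  split; first exact: init_entry.
  move=> E; rewrite /init_fill E /=; case: ifP => // h.
  by have := tab_dom T i j; rewrite E domT inE (proj1 (maxC _ h)).
have Ymv i j v : (m < v)%R -> Ym i j = entry v <-> tab T i j = Some v.
  by move=> mv; rewrite -initE; apply: (slide_seq_before _ _ sq); lia.
have YmN i j : Ym i j <> None <-> ((i, j) : box) \in domf T `|` C.
  have H t : run lo t (init_fill C T) i j = None <-> init_fill C T i j = None.
    by elim: t => //= t IH; rewrite step_None.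
  rewrite H inE tab_dom /init_fill orbC; case: ifP => //= _.
  by case: (tab T i j) => [v|] //=; split.
pose C1 := [fset x in domf T `|` C | Ym x.1 x.2 == bullet].
have C1E i j : (((i, j) : box) \in C1) = (Ym i j == bullet).
  rewrite !inE /=; case: eqP => [E|]; last by rewrite andbF.
  by rewrite andbT -in_fsetU; apply/YmN; rewrite E.
have sd1 : slide_data nu (nu `\` domf (above m T)) C1 (above m T).
  split; [exact: skew_above sp|exact: increasing_above|move=> [i j]].
  rewrite C1E => /eqP E.
  have ijD : ((i, j) : box) \in domf T `|` C by apply/YmN; rewrite E.
  split.
    rewrite in_fsetD; apply/andP; split.
      rewrite tab_dom; case E1: (tab (above m T) i j) => [v|] //.
      by have [/(Ymv i j v) H mv] := (tab_above m T i j v).1 E1; rewrite E in H; case: (H mv).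
    move: ijD; rewrite !inE => /orP[|/maxC[h _]]; last exact: (fsubsetP lanu).
    by rewrite domT inE => /andP[].
  move=> [k1 l1]; rewrite in_fsetD => /andP[h kl] lt.
  have [lt1 lt2 ne] : [/\ i <= k1, j <= l1 & (i, j) <> (k1, l1)].
    by move: lt; rewrite box_ltE => /and3P[h1 h2 h3]; split => // -[]; lia.
  (* A box of [T] after the bullet holds a value [> m], so it is not in the new inner shape; a box
     of [la] after it would contradict the maximality of the boxes of [C]. *)
  have [kT|kT] := boolP (((k1, l1) : box) \in domf T).
    case E1: (Ym k1 l1) => [c|]; last first.
      by have := (YmN k1 l1).2; rewrite E1 inE kT; apply.
    have := good_lt gm lt1 lt2 ne E E1; case: c E1 => [v|] //= E1 mv.
    have mv' : (m < v)%R by lia.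
    have e := (Ymv _ _ _ mv').1 E1.
    by case/negP: h; rewrite tab_dom; have -> : tab (above m T) k1 l1 = Some v by apply/tab_above.
  have kla : ((k1, l1) : box) \in la by move: kT; rewrite domT inE kl andbT negbK.
  have ila : ((i, j) : box) \in la by apply: sla kla; apply: ltW.
  move: ijD; rewrite inE domT inE ila /= => /maxC[_ H]; exact: H kla lt.
exists nu, (nu `\` domf (above m T)), C1, p, q.
have [sp1 inc1 maxC1] := sd1.
have pq2 i j v : tab (above m T) i j = Some v -> (p <= v <= q)%R.
  by move=> /tab_above[/pq1].
split => //; first by move=> x; have := tab_val x; apply: pq2.
apply: tab_inj => i j; rewrite (jdt_run (p1 := (m + 1)%R) (n := n) sd1 pq2); last first.
  by move=> k1 l1 v /tab_above[/b]; lia.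
have -> : init_fill C1 (above m T) = fill_above m Ym.
  apply/funext => k1; apply/funext => l1; rewrite /init_fill C1E /fill_above.
  case: eqP => [->//|ne].
  case E: (tab (above m T) k1 l1) => [v|] /=.
    have [e mv] := (tab_above m T k1 l1 v).1 E.
    by rewrite ((Ymv _ _ _ mv).2 e) mv.
  case E1: (Ym k1 l1) => [[v|]|] //.
  case: ifP => // mv; have e := (Ymv _ _ _ mv).1 E1.
  by have := (tab_above m T k1 l1 v).2 (conj e mv); rewrite E.
rewrite run_above; last lia.
have -> : run (m + 1)%R n Ym = run lo (k + n) (init_fill C T).
  rewrite /Ym -Ek; elim: n {b ET pq2} => [|t IH]; first by rewrite addn0.
  by rewrite addnS /= IH; congr (step _ _); lia.
rewrite /fill_above; have := ET i j; case: (run _ _ _ _ _) => [[v|]|] //= E.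
- case: ifP => mv /=; first by apply/tab_above; split.
  case E1: (tab (above m T1) i j) => [u|] //.
  by have [e mu] := (tab_above m T1 i j u).1 E1; rewrite E in e; case: e => e; rewrite e mu in mv.
- case E1: (tab (above m T1) i j) => [u|] //.
  by have [e mu] := (tab_above m T1 i j u).1 E1; rewrite E in e.
- case E1: (tab (above m T1) i j) => [u|] //.
  by have [e mu] := (tab_above m T1 i j u).1 E1; rewrite E in e.
Qed.

Lemma slides_above m T T1 : slides T T1 -> slides (above m T) (above m T1).
Proof.
elim=> [A B /(forward_slide_above m)|A|A B D _ h1 _ h2]; [exact: rt_step|exact: rt_refl|].
exact: rt_trans h1 h2.
Qed.

(** * A translated straight tableau slides back *)

Lemma tab_translate b c U i j :
  tab (translate b c U) i j =
  if (b <= i) && (c <= j) then tab U (i - b) (j - c) else None.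
Proof.
rewrite /tab /translate.
have mem : (((i, j) : box) \in [fset ((b + y.1, c + y.2)%N : box) | y in domf U]) =
    [&& b <= i, c <= j & isSome (tab U (i - b) (j - c))].
  apply/imfsetP/and3P => [[[k l] /= h [-> ->]]|[bi cj h]].
    by rewrite !leq_addr !addKn -tab_dom.
  exists ((i - b, j - c) : box); first by rewrite /= tab_dom.
  by congr pair; rewrite /=; lia.
have [h|h] := boolP (((i, j) : box) \in [fset ((b + y.1, c + y.2)%N : box) | y in domf U]).
  rewrite (fnd_fmap _ h) /=; move: h; rewrite mem => /and3P[-> ->] /=.
  by rewrite /tab; case: (U.[? _]).
rewrite not_fnd //; move: h; rewrite mem; case: ifP => [/andP[-> ->]|_] //=.
by rewrite /tab; case: (U.[? _]).
Qed.

Definition rect (A B : nat) (P : nat -> nat -> bool) : {fset box} :=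
  [fset x in [seq ((i, j) : box) | i <- iota 0 A, j <- iota 0 B] | P x.1 x.2].

Lemma mem_rect A B P i j : (((i, j) : box) \in rect A B P) = [&& i < A, j < B & P i j].
Proof.
rewrite !inE /= andbA; congr (_ && _).
apply/allpairsP/andP => [[[k l] /= [hk hl [-> ->]]]|[hi hj]].
  by move: hk hl; rewrite !mem_iota.
by exists (i, j); rewrite !mem_iota.
Qed.

Lemma tab_support T : exists A B, forall i j v, tab T i j = Some v -> i < A /\ j < B.
Proof.
have [A hA] := row_bound T; have [B hB] := row_bound (tr T).
exists A, B => i j v E; split; first exact: hA E.
by apply: (hB j i v); rewrite tab_tr.
Qed.

(* [U] moved to column [c] and to row [b + 1], except that the columns [>= k]
   of [U] have already been moved up to row [b]. *)
Definition mixed (U : {fmap box -> int}) (A B b c k : nat) : {fmap box -> int} :=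
  make (rect (b.+1 + A) (c + B) (fun _ _ => true)) (fun i j =>
    if c <= j then
      if j < c + k then if b < i then tab U (i - b.+1) (j - c) else None
      else if b <= i then tab U (i - b) (j - c) else None
    else None).

Lemma tab_mixed U A B b c k i j :
  (forall i j v, tab U i j = Some v -> i < A /\ j < B) ->
  tab (mixed U A B b c k) i j =
    if c <= j then
      if j < c + k then if b < i then tab U (i - b.+1) (j - c) else None
      else if b <= i then tab U (i - b) (j - c) else None
    else None.
Proof.
move=> bd; rewrite tab_make mem_rect andbT.
set F := (X in _ = X); case: ifP => // /negbT h.
case E: F => [v|] //; exfalso; move: E h; rewrite /F.
by case: (leqP c j) => // cj; case: (ltnP j (c + k)) => _; case: ifP => // bi /bd; lia.
Qed.

Definition below_value (s : int) (o : option int) : bool :=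
  if o is Some v then (v < s)%R else false.

(* Column [k] of [U] while it is being moved up, before the swap with [s]. *)
Definition moving_column (U : {fmap box -> int}) (k : nat) (s : int) (i : nat) :
    option (option int) :=
  if below_value s (tab U i k) then omap Some (tab U i k)
  else if (i == 0) || below_value s (tab U i.-1 k) then bullet
  else omap Some (tab U i.-1 k).

Lemma moving_low U k s r v : tab U r k = Some v -> (v < s)%R ->
  moving_column U k s r = entry v.
Proof. by rewrite /moving_column => -> /= ->. Qed.

Lemma moving_bullet U k s r : ~~ below_value s (tab U r k) ->
  (r == 0) || below_value s (tab U r.-1 k) -> moving_column U k s r = bullet.
Proof. by rewrite /moving_column => /negbTE -> ->. Qed.

Lemma moving_high U k s r : ~~ below_value s (tab U r.+1 k) ->
  ~~ below_value s (tab U r k) -> moving_column U k s r.+1 = omap Some (tab U r k).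
Proof. by rewrite /moving_column => /negbTE -> /= /negbTE ->. Qed.

Definition moving (U : {fmap box -> int}) (A B b c k : nat) (s : int) : fill := fun i j =>
  if j == (c + k)%N then if b <= i then moving_column U k s (i - b) else None
  else omap Some (tab (mixed U A B b c k.+1) i j).

(** The bullet goes straight down: below it is an entry of some row of [U] in column [k], and to its
    right, already moved up, the entry of the same row of [U] in column [k + 1], which is larger. *)
Lemma moving_step U A B b c k s : straight (domf U) -> increasing U ->
  (forall i j v, tab U i j = Some v -> i < A /\ j < B) ->
  step s (moving U A B b c k s) = moving U A B b c k (s + 1)%R.
Proof.
move=> /straightP sU /increasingP inc bd.
have dom i j i1 j1 v : i <= i1 -> j <= j1 -> tab U i1 j1 = Some v ->
    exists2 u, tab U i j = Some u & (i, j) <> (i1, j1) -> (u < v)%R.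
  move=> ii jj E; have : ((i, j) : box) \in domf U.
    by apply: sU ii jj _; rewrite tab_dom E.
  rewrite tab_dom; case E1: (tab U i j) => [u|] // _; exists u => // ne.
  exact: inc ii jj ne E1 E.
apply/funext => i; apply/funext => j; rewrite /step.
have [Ej|nj] := eqVneq j (c + k)%N; last first.
  have -> : moving U A B b c k (s + 1)%R i j = omap Some (tab (mixed U A B b c k.+1) i j).
    by rewrite /moving (negbTE nj).
  have -> : moving U A B b c k s i j = omap Some (tab (mixed U A B b c k.+1) i j).
    by rewrite /moving (negbTE nj).
  case E: (tab (mixed U A B b c k.+1) i j) => [v|] //=.
  case: ifP => // /andP[/eqP Ev /orP[]/andP[pos /eqP h]]; subst v; exfalso.
    move: h; rewrite /moving; case: (eqVneq j.-1 (c + k)%N) => [Ej1|_]; last by case: (tab _ _ _).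
    case: ifP => // bi; rewrite /moving_column.
    move: E; rewrite tab_mixed //; have -> : c <= j by lia.
    have -> : (j < (c + k.+1)%N) = false by lia.
    rewrite bi => E.
    have kj : k <= j - c by lia.
    have [u Eu] := dom (i - b) k (i - b) (j - c) s (leqnn _) kj E.
    have ne : (i - b, k) <> (i - b, j - c) by case; lia.
    by move=> /(_ ne) us; rewrite Eu /= us.
  move: h; rewrite /moving (negbTE nj); by case: (tab _ _ _).
subst j.
have here t r : moving U A B b c k t r (c + k)%N =
    if b <= r then moving_column U k t (r - b) else None by rewrite /moving eqxx.
rewrite (here s i) (here (s + 1)%R i); case: (leqP b i) => bi //.
have [r Er] : exists r, i = (b + r)%N by exists (i - b); rewrite subnKC.
subst i; rewrite addKn.
have right : (moving U A B b c k s (b + r)%N (c + k)%N.+1 == entry s) ->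
    below_value s (tab U r k).
  rewrite /moving; have -> : ((c + k)%N.+1 == (c + k)%N) = false by lia.
  rewrite tab_mixed //; have -> : c <= (c + k)%N.+1 by lia.
  have -> : ((c + k)%N.+1 < (c + k.+1)%N) = false by lia.
  rewrite leq_addr addKn; case E: (tab U _ _) => [v|] //= /eqP[Ev]; subst v.
  have kj : k <= (c + k)%N.+1 - c by lia.
  have [u -> H] := dom r k r _ s (leqnn _) kj E.
  by apply: H; case; lia.
have left : ((0 < c + k) && (moving U A B b c k s (b + r)%N (c + k)%N.-1 == bullet)) = false.
  apply/negbTE/negP => /andP[pos /eqP]; rewrite /moving; have -> : ((c + k)%N.-1 == (c + k)%N) = false by lia.
  by case: (tab _ _ _).
have down : moving U A B b c k s (b + r)%N.+1 (c + k)%N = moving_column U k s r.+1.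
  have e1 : b <= (b + r)%N.+1 by lia.
  have e2 : ((b + r).+1 - b = r.+1)%N by lia.
  by rewrite here e1 e2.
have up : ((0 < b + r) && (moving U A B b c k s (b + r)%N.-1 (c + k)%N == bullet)) =
    (0 < r) && (moving_column U k s r.-1 == bullet).
  case: r {right left down bi} => [|r]; last first.
    have e1 : b <= (b + r.+1)%N.-1 by lia.
    have e2 : ((b + r.+1).-1 - b = r)%N by lia.
    by rewrite here e1 e2 addnS.
  rewrite here; case: (leqP b (b + 0).-1) => h; last by rewrite andbF.
  by apply/negbTE/negP => /andP[]; lia.
rewrite left up down {left up down} /=.
have colinc r1 r2 v : r1 < r2 -> tab U r2 k = Some v ->
    exists2 u, tab U r1 k = Some u & (u < v)%R.
  move=> lt E; have [u e H] := dom r1 k r2 k v (ltnW lt) (leqnn k) E.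
  by exists u => //; apply: H; case; lia.
have belowS r1 : below_value s (tab U r1.+1 k) -> below_value s (tab U r1 k).
  case E: (tab U r1.+1 k) => [v|] //= vs.
  by have [u -> /=] := colinc r1 r1.+1 v (ltnSn _) E; lia.
have belowW o : below_value s o -> below_value (s + 1)%R o.
  by case: o => //= v; lia.
case: (boolP (below_value s (tab U r k))) => low.
  case E: (tab U r k) low => [v|] //= vs.
  rewrite !(moving_low E) //; last lia.
  by have -> : (v == s) = false by lia.
have nlow1 : ~~ below_value s (tab U r.+1 k) by apply: contra low; apply: belowS.
case: (boolP ((r == 0) || below_value s (tab U r.-1 k))) => top.
  rewrite (moving_bullet low top) (negbTE (contra right low)) /= moving_high //.
  case E: (tab U r k) low => [v|] /= low.
    have [Ev|nv] := eqVneq v s.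
      by subst v; rewrite eqxx (moving_low E) //; lia.
    have -> : (entry v == entry s) = false by apply/negbTE/eqP => -[Ev]; rewrite Ev eqxx in nv.
    rewrite moving_bullet //; first by rewrite E /=; lia.
    by case/orP: top => [->//|/belowW ->]; rewrite orbT.
  rewrite moving_bullet //; first by rewrite E.
  by case/orP: top => [->//|/belowW ->]; rewrite orbT.
case: r right low nlow1 top bi here => [//|r] right low nlow1 top bi here.
rewrite /= in top; rewrite moving_high //.
case E: (tab U r k) top => [v|] /= top; last first.
  have E1 : tab U r.+1 k = None.
    by case E1: (tab U r.+1 k) => [v|] //; have [u] := colinc r r.+1 v (ltnSn _) E1; rewrite E.
  by rewrite moving_high ?E ?E1.
have up1 : ~~ below_value (s + 1)%R (tab U r.+1 k).
  case E1: (tab U r.+1 k) => [w|] //=.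
  by have [u] := colinc r r.+1 w (ltnSn _) E1; rewrite E => -[<-]; lia.
have [Ev|nv] := eqVneq v s.
  subst v; rewrite (moving_bullet (r := r)) ?E //= ?eqxx.
    by rewrite moving_bullet //= E /=; lia.
  case: r E {right low nlow1 top bi here up1} => [//|r] E /=.
  by have [u -> /=] := colinc r r.+1 s (ltnSn _) E.
by rewrite /= moving_high ?E //=; lia.
Qed.

Lemma mixed_slide U A B b c k : straight (domf U) -> increasing U ->
  (forall i j v, tab U i j = Some v -> i < A /\ j < B) -> isSome (tab U 0 k) ->
  forward_slide (mixed U A B b c k.+1) (mixed U A B b c k).
Proof.
move=> sU inc bd Uk.
have kB : k < B by case E: (tab U 0 k) Uk => [v|] // _; have := bd _ _ _ E; lia.
have sub i j i1 j1 : i <= i1 -> j <= j1 -> isSome (tab U i1 j1) -> isSome (tab U i j).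
  by rewrite -!tab_dom; move/straightP: sU => H; apply: H.
have [p [n b0]] := tab_bounds U.
(* The inner shape has full height left of column [c], [b + 1] rows in the columns not yet moved and
   [b] rows in the others. Its corner [(b, c + k)] is where the slide starts. *)
pose la := rect (b.+1 + A) (c + B) (fun i j =>
  if j < c then true else if j < (c + k.+1)%N then i < b.+1 else i < b).
have laE i j : (((i, j) : box) \in la) = (j < c + B) &&
    (if j < c then i < (b.+1 + A)%N else if j < (c + k.+1)%N then i < b.+1 else i < b).
  rewrite mem_rect andbCA; congr (_ && _).
  case: (ltnP j c) => _; first by rewrite andbT.
  by case: (ltnP j (c + k.+1)) => _; apply/andP/idP => [[]//|h]; split => //; lia.
have domE i j : (((i, j) : box) \in domf (mixed U A B b c k.+1)) =
    (c <= j) && (if j < (c + k.+1)%N then (b < i) && isSome (tab U (i - b.+1) (j - c))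
                 else (b <= i) && isSome (tab U (i - b) (j - c))).
  rewrite tab_dom tab_mixed //; case: (leqP c j) => // cj /=.
  by case: (ltnP j (c + k.+1)) => _; case: ifP.
pose nu := la `|` domf (mixed U A B b c k.+1).
have sp : skew_presentation nu la (domf (mixed U A B b c k.+1)).
  split.
  - apply/straightP => i j i1 j1 ii jj; rewrite !in_fsetU !laE !domE.
    pose u r l := isSome (tab U r l).
    have bu r l : u r l -> r < A /\ l < B.
      by rewrite /u; case E: (tab U r l) => [v|] // _; apply: bd E.
    have {}sub r l r1 l1 : r <= r1 -> l <= l1 -> u r1 l1 -> u r l by exact: sub.
    rewrite -!/(u _ _).
    have s1 := sub (i - b.+1) (j - c) (i1 - b.+1) (j1 - c) ltac:(lia) ltac:(lia).
    have s2 := sub (i - b.+1) (j - c) (i1 - b) (j1 - c) ltac:(lia) ltac:(lia).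
    have s3 := sub (i - b) (j - c) (i1 - b) (j1 - c) ltac:(lia) ltac:(lia).
    have b1 := bu (i1 - b.+1) (j1 - c); have b2 := bu (i1 - b) (j1 - c).
    move: s1 s2 s3 b1 b2; clear -ii jj kB.
    move: (u _ _) (u _ _) (u _ _) (u _ _) => u1 u2 u3 u4 s1 s2 s3 b1 b2.
    case: (ltnP j1 c) => h1; case: (ltnP j1 (c + k.+1)) => h2; case: (ltnP j c) => h3;
      case: (ltnP j (c + k.+1)) => h4; lia.
  - apply/straightP => i j i1 j1 ii jj; rewrite !laE => /andP[h].
    have -> : j < c + B by lia.
    case: (ltnP j c) => h1; case: (ltnP j1 c) => h2; try lia; first by case: ifP; lia.
    by case: (ltnP j (c + k.+1)) => h3; case: (ltnP j1 (c + k.+1)) => h4; lia.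
  - exact: fsubsetUl.
  - apply/fsetP => -[i j]; rewrite in_fsetD in_fsetU.
    case h: (_ \in la) => //=; move: h; rewrite laE domE.
    case: (leqP c j) => h //=.
    case: (ltnP j (c + k.+1)) => h1; first by case: (ltnP b i) => //=; lia.
    by case: (leqP b i) => //=; lia.
pose x0 : box := (b, (c + k)%N).
have sd : slide_data nu la [fset x0] (mixed U A B b c k.+1).
  split=> //.
    apply/increasingP => i j i1 j1 u v ii jj ne; rewrite !tab_mixed //.
    move/increasingP: inc => inc.
    case: (leqP c j) => // cj; case: (leqP c j1) => // cj1.
    case: (ltnP j (c + k.+1)) => h; case: (ltnP j1 (c + k.+1)) => h1;
      case: ifP => // bi; case: ifP => // bi1; apply: inc; try lia;
      by case=> *; apply: ne; congr pair; lia.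
  move=> [i j]; rewrite inE => /eqP[-> ->]; split.
    have e1 : (c + k < c) = false by lia.
    have e2 : c + k < c + k.+1 by lia.
    by rewrite laE e1 e2; lia.
  move=> [i1 j1]; rewrite laE box_ltE.
  by case: (ltnP j1 c); case: (ltnP j1 (c + k.+1)); lia.
have bm i j v : tab (mixed U A B b c k.+1) i j = Some v -> (p <= v < p + n%:Z)%R.
  rewrite tab_mixed //; case: (leqP c j) => // cj.
  by case: (ltnP j (c + k.+1)) => h; case: ifP => // bi; apply: b0.
have ini : init_fill [fset x0] (mixed U A B b c k.+1) = moving U A B b c k p.
  have lowF o : (forall v, o = Some v -> (p <= v)%R) -> below_value p o = false.
    by case: o => //= v /(_ v erefl); lia.
  have lowU i j : below_value p (tab U i j) = false by apply: lowF => v /b0; lia.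
  apply/funext => i; apply/funext => j; rewrite /init_fill /moving inE.
  have [->|nj] := eqVneq j (c + k)%N; last first.
    by case: eqP => // -[_ E]; rewrite E eqxx in nj.
  rewrite /moving_column !lowU orbF tab_mixed //.
  have -> : c <= c + k by lia.
  have -> : c + k < c + k.+1 by lia.
  case: eqP => [[->]|ne]; first by rewrite leqnn subnn.
  have nb : i <> b by move=> E; apply: ne; rewrite E.
  case: (ltnP b i) => bi; last by have -> : (b <= i) = false by lia.
  have -> : b <= i by lia.
  have -> : (i - b == 0) = false by lia.
  have -> : ((i - b).-1 = i - b.+1)%N by lia.
  by have -> : (c + k - c = k)%N by lia.
have runm t : run p t (moving U A B b c k p) = moving U A B b c k (p + t%:Z)%R.
  elim: t => [|t IH] /=; first by rewrite addr0.
  by rewrite IH moving_step //; congr moving; lia.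
exists nu, la, [fset x0], p, (p + n%:Z)%R; case: (sd) => _ incm maxC; split => //.
  by move=> x; have := bm _ _ _ (tab_val x); lia.
have bq i j v : tab (mixed U A B b c k.+1) i j = Some v -> (p <= v <= p + n%:Z)%R.
  by move/bm; lia.
apply: tab_inj => i j; rewrite (jdt_run sd bq bm) ini runm /moving.
have [->|nj] := eqVneq j (c + k)%N; last first.
  rewrite !tab_mixed //.
  have -> : (j < c + k.+1) = (j < c + k) by lia.
  have odfK o : odflt None (omap Some o) = o :> option int by case: o.
  by rewrite odfK.
rewrite tab_mixed //.
have -> : c <= c + k by lia.
have -> : (c + k < c + k) = false by lia.
have -> : (c + k - c = k)%N by lia.
case: (leqP b i) => // bi; rewrite /moving_column.
case E: (tab U (i - b) k) => [v|] /=.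
  by have -> : (v < p + n%:Z)%R by have := b0 _ _ _ E; lia.
case: ifP => // /norP[i0]; case E1: (tab U _ k) => [v|] //= h.
by have := b0 _ _ _ E1; lia.
Qed.

(** The columns are moved one by one from right to left; columns without entries of [U] need no
    slide. *)
Lemma translate_up b c U : straight (domf U) -> increasing U ->
  slides (translate b.+1 c U) (translate b c U).
Proof.
move=> sU inc; have [A [B bd]] := tab_support U.
have out i j : B <= j -> tab U i j = None.
  by move=> Bj; case E: (tab U i j) => [v|] //; have := bd _ _ _ E; lia.
have -> : translate b.+1 c U = mixed U A B b c B.
  apply: tab_inj => i j; rewrite tab_translate tab_mixed //.
  case: (leqP c j) => cj; rewrite ?andbF // andbT.
  by case: (ltnP j (c + B)) => jB //; rewrite !out ?if_same //; lia.
have -> : translate b c U = mixed U A B b c 0.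
  apply: tab_inj => i j; rewrite tab_translate tab_mixed //.
  case: (leqP c j) => cj; rewrite ?andbF // andbT.
  by have -> : (j < c + 0) = false by lia.
elim: {2}B => [|k IH]; first exact: rt_refl.
apply: rt_trans IH; case: (boolP (isSome (tab U 0 k))) => h.
  by apply: rt_step; apply: mixed_slide.
have -> : mixed U A B b c k.+1 = mixed U A B b c k; last exact: rt_refl.
have no r : tab U r k = None.
  apply/eqP; apply: contraR h => h; rewrite -tab_dom; move/straightP: sU => H.
  by apply: (H _ _ r k) => //; rewrite tab_dom; case: (tab U r k) h.
apply: tab_inj => i j; rewrite !tab_mixed //.
case: (leqP c j) => // cj.
have [Ej|nj] := eqVneq j (c + k)%N.
  have -> : (j - c = k)%N by lia.
  by rewrite !no !if_same.
by have -> : (j < c + k.+1) = (j < c + k) by lia.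
Qed.

Lemma translate_tr b c U : translate b c (tr U) = tr (translate c b U).
Proof.
apply: tab_inj => i j; rewrite tab_tr !tab_translate tab_tr.
by rewrite andbC.
Qed.

Lemma translate0 U : translate 0 0 U = U.
Proof. by apply: tab_inj => i j; rewrite tab_translate /= !subn0. Qed.

Lemma slides_translate b c U : straight (domf U) -> increasing U ->
  slides (translate b c U) U.
Proof.
move=> sU inc; apply: (rt_trans _ _ _ (translate 0 c U)).
  elim: b => [|b IH]; first exact: rt_refl.
  exact: rt_trans (translate_up b c sU inc) IH.
elim: c => [|c IH]; first by rewrite translate0; exact: rt_refl.
apply: rt_trans IH.
have -> : translate 0 c.+1 U = tr (translate c.+1 0 (tr U)) by rewrite translate_tr trK.
have -> : translate 0 c U = tr (translate c 0 (tr U)) by rewrite translate_tr trK.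
apply/slides_tr/translate_up; last exact: increasing_tr.
by rewrite dom_tr; apply: straight_flip.
Qed.

(** * Consequences of the invariance of chains *)

Lemma forward_slide_increasing T T1 : forward_slide T T1 -> increasing T1.
Proof.
move=> /forward_slide_run[nu [la [C [sd H]]]].
have [p [n b]] := tab_bounds T.
have g : good p (init_fill C T) by apply: (init_good sd) => i j v /b; lia.
have g1 := run_good n g.
apply/increasingP => i j k l u v ik jl ne; rewrite !(H _ _ b).
case E: (run _ _ _ i j) => [[u1|]|] //= -[<-]; case E1: (run _ _ _ k l) => [[v1|]|] //= -[<-].
by have := good_lt g1 ik jl ne E E1.
Qed.

Lemma slides_increasing T T1 : slides T T1 -> increasing T -> increasing T1.
Proof. by elim=> [A B /forward_slide_increasing|A|A B D _ h1 _ h2] // /h1/h2. Qed.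

Lemma increasing_col_lt T k c k1 c1 v w : increasing T -> k <= k1 ->
  tab T k c = Some v -> tab T k1 c1 = Some w -> (w < v)%R -> c1 < c.
Proof.
move=> /increasingP inc kk E E1 wv; rewrite ltnNge; apply/negP => cc.
have [[e1 e2]|ne] := pselect ((k, c) = (k1, c1)).
  by subst k1 c1; move: E1; rewrite E => -[]; lia.
by have := inc _ _ _ _ _ _ kk cc ne E E1; lia.
Qed.

(** A smaller entry that is weakly lower lies strictly to the left, so a chain uses distinct
    columns. *)
Lemma chain_col T x m t k c : increasing T -> tab T k c = Some (x + t%:Z)%R ->
  chain (row_has T) x m t k -> m <= c.
Proof.
move=> inc; elim: m t k c => // m IH t k c E [t1 [k1 [tt kk [c1 E1] ch]]].
have mc := IH _ _ _ E1 ch.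
have : c1 < c by apply: (increasing_col_lt inc kk E E1); lia.
lia.
Qed.

Lemma chain_window R x m t k : chain R x m t k -> m <= t.
Proof.
elim: m t k => // m IH t k [t1 [k1 [tt kk _ /IH]]]; lia.
Qed.

Lemma chain_top T x m i : increasing T -> chain (row_has T) x m.+1 m.+1 i ->
  exists k c, [/\ i <= k, m <= c, tab T k c = Some (x + m%:Z)%R &
                  chain (row_has T) x m m k].
Proof.
move=> inc [t [k [tm ik [c E] ch]]].
have Et : t = m by have := chain_window ch; lia.
by subst t; exists k, c; split => //; apply: chain_col ch.
Qed.

(** A chain of [m] entries with [m] available values and [m] available columns must use them all, in
    order. *)
Lemma chain_full T x m i : increasing T -> chain (row_has T) x m m i ->
  (forall k t j, i <= k -> t < m -> tab T k j = Some (x + t%:Z)%R -> j < m) ->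
  forall r, r < m -> exists k, tab T k r = Some (x + r%:Z)%R.
Proof.
move=> inc; elim: m i => // m IH i ch bd r rm.
have [k [c [ik mc E ch1]]] := chain_top inc ch.
have Ec : c = m by have := bd _ _ _ ik (ltnSn m) E; lia.
subst c; have [Er|nr] := eqVneq r m; first by subst r; exists k.
apply: (IH k) => //; last lia.
by move=> k1 t j kk tm E1; apply: (increasing_col_lt inc kk E E1); lia.
Qed.

Lemma chain_intro (R : nat -> int -> Prop) x m (rw : nat -> nat) :
  (forall r, r < m -> R (rw r) (x + r%:Z)%R) ->
  (forall r, r.+1 < m -> rw r.+1 <= rw r) ->
  chain R x m m 0.
Proof.
case: m => // m HR Hm; suff : chain R x m.+1 m.+1 (rw m) by apply: chain_mono; lia.
elim: m HR Hm => [|m IH] HR Hm.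
  by exists 0, (rw 0); split => //; apply: HR.
exists m.+1, (rw m.+1); split => //; first exact: HR.
have : chain R x m.+1 m.+1 (rw m) by apply: IH => r rm; [apply: HR|apply: Hm]; lia.
by apply: chain_mono => //; apply: Hm.
Qed.

Lemma straight_tab V i j k l v : straight (domf V) -> i <= k -> j <= l ->
  tab V k l = Some v -> exists u, tab V i j = Some u.
Proof.
move=> /straightP sV ik jl E; have : ((i, j) : box) \in domf V.
  by apply: sV ik jl _; rewrite tab_dom E.
by rewrite tab_dom; case: (tab V i j) => [u|] // _; exists u.
Qed.

Lemma slides_cols T N V a : slides T N -> slides T V -> increasing T ->
  straight (domf V) -> (forall i j v, tab N i j = Some v -> j < a) ->
  forall i j v, tab V i j = Some v -> j < a.
Proof.
move=> TN TV inc sV bd i j v0 E0.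
have [v E] := straight_tab sV (leq0n i) (leqnn j) E0.
have [x [n b]] := tab_bounds V.
have incV := slides_increasing TV inc; have incN := slides_increasing TN inc.
have : chain (row_has V) x j.+1 n 0.
  have H l w : tab V 0 l = Some w -> chain (row_has V) x l `|w - x|%N 0.
    elim: l w => // l IH w Ew.
    have [u Eu] := straight_tab sV (leqnn 0) (leqnSn l) Ew.
    have uw : (u < w)%R.
      by move/increasingP: incV => H; apply: H (leqnn 0) (leqnSn l) _ Eu Ew; case; lia.
    exists `|u - x|%N, 0; have := b _ _ _ Eu; have := b _ _ _ Ew; split => //; first lia.
      by exists l; rewrite Eu; congr Some; lia.
    exact: IH.
  exists `|v - x|%N, 0; have := b _ _ _ E; split => //; first lia.
    by exists j; rewrite E; congr Some; lia.
  exact: H.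
rewrite -(slides_chain _ _ _ TV) (slides_chain _ _ _ TN) => -[t [k [_ _ [c Ec] ch]]].
by have := chain_col incN Ec ch; have := bd _ _ _ Ec; lia.
Qed.

Lemma slides_value T N V i j v : slides T N -> slides T V -> tab V i j = Some v ->
  exists k l, tab N k l = Some v.
Proof.
move=> TN TV E; have : chain (row_has V) v 1 1 0.
  by exists 0, i; split => //; exists j; rewrite E addr0.
rewrite -(slides_chain _ _ _ TV) (slides_chain _ _ _ TN).
by case=> t [k [t0 _ [l El] _]]; exists k, l; rewrite El; congr Some; lia.
Qed.

Lemma straight_ge V i j v : straight (domf V) -> increasing V ->
  (forall i j v, tab V i j = Some v -> (1 <= v)%R) ->
  tab V i j = Some v -> ((i + j).+1%:Z <= v)%R.
Proof.
move=> sV /increasingP inc ge1; move En : (i + j)%N => n.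
elim: n i j v En => [|n IH] i j v En E; first by have := ge1 _ _ _ E; lia.
case: i En E => [|i] En E.
  case: j En E => [|j] En E; first lia.
  have [u Eu] := straight_tab sV (leqnn 0) (leqnSn j) E.
  have := IH 0 j u ltac:(lia) Eu.
  by have := inc _ _ _ _ _ _ (leqnn 0) (leqnSn j) ltac:(case; lia) Eu E; lia.
have [u Eu] := straight_tab sV (leqnSn i) (leqnn j) E.
have := IH i j u ltac:(lia) Eu.
by have := inc _ _ _ _ _ _ (leqnSn i) (leqnn j) ltac:(case; lia) Eu E; lia.
Qed.

(** By [chain_full], column [j] contains each value [t + 1 + j] with [t < b]. The lower bound
    [i + j + 1] for box [(i, j)] keeps this value in a row [<= t], and the value before it, already
    placed in row [t - 1], pushes it below that row. *)
Lemma minimal_block V a b : straight (domf V) -> increasing V ->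
  (forall i j v, tab V i j = Some v -> (1 <= v)%R) ->
  (forall i j v, tab V i j = Some v -> j < a) ->
  (forall t, t < b -> chain (row_has V) (t.+1%:Z)%R a a 0) ->
  forall i j, i < b -> j < a -> tab V i j = Some ((i + j + 1)%N%:Z)%R.
Proof.
move=> sV inc ge1 bd H i j ib ja.
have col t : t < b -> exists k, tab V k j = Some (t.+1%:Z + j%:Z)%R.
  by move=> tb; apply: (chain_full inc (H t tb)) => // k t1 j1 _ _ /bd.
elim: i ib => [|i IH] ib.
  have [k E] := col 0 ib; have := straight_ge sV inc ge1 E => le.
  have Ek : k = 0 by lia.
  by subst k; rewrite E; congr Some; lia.
have [k E] := col i.+1 ib; have := straight_ge sV inc ge1 E => le.
have E1 := IH (ltnW ib).
suff Ek : k = i.+1 by subst k; rewrite E; congr Some; lia.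
suff : i < k by lia.
rewrite ltnNge; apply/negP => ki.
have [Ek|ne] := eqVneq k i; first by subst k; move: E1; rewrite E => -[]; lia.
move/increasingP: inc => inc.
have ne' : (k, j) <> (i, j) by case=> Ek; rewrite Ek eqxx in ne.
by have := inc _ _ _ _ _ _ ki (leqnn j) ne' E E1; lia.
Qed.

(** * Fat hooks *)

Definition hook (a b c d i j : nat) : bool := (i < b) && (j < a) || (i < b + d) && (j < c).

Lemma mem_fat_hook a b c d i j : c <= a ->
  (((i, j) : box) \in fat_hook a b c d) = hook a b c d i j.
Proof.
move=> ca; rewrite /fat_hook /young !inE /=.
have E k : nth 0 (nseq b a ++ nseq d c) k = if k < b then a else if k < b + d then c else 0.
  by rewrite nth_cat size_nseq !nth_nseq; case: ltnP => // h; congr (if _ then _ else _); lia.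
apply/allpairsPdep/idP => [[k [l [/= hk hl [-> ->]]]]|h].
  move: hk hl; rewrite !mem_iota size_cat !size_nseq E /hook.
  by case: ifP => h1; [|case: ifP => h2]; lia.
exists i, j; move: h; rewrite !mem_iota size_cat !size_nseq E /hook.
by case: (ltnP i b) => h1; [|case: (ltnP i (b + d)) => h2]; split => //; lia.
Qed.

Lemma tab_minimal la i j : tab (minimal_tableau la) i j =
  if ((i, j) : box) \in la then Some ((i + j + 1)%N%:Z)%R else None.
Proof.
rewrite /tab /minimal_tableau; case: ifP => h; first by rewrite (fnd_fmap _ h).
by rewrite not_fnd //= h.
Qed.

Lemma tab_attach a b c d U i j w : c <= a ->
  tab (attach a b c d U) i j = Some w <->
  (hook a b c d i j /\ w = (i + j + 1)%N%:Z%R) \/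
  [/\ b <= i, c <= j & tab U (i - b) (j - c) = Some w].
Proof.
move=> ca.
have -> : tab (attach a b c d U) i j =
    if isSome (tab (translate b c U) i j) then tab (translate b c U) i j
    else tab (minimal_tableau (fat_hook a b c d)) i j.
  by rewrite {1}/tab /attach fnd_cat tab_dom.
rewrite tab_minimal mem_fat_hook // tab_translate.
have disj : b <= i -> c <= j -> hook a b c d i j = false.
  by rewrite /hook => h1 h2; apply/negbTE; lia.
case: (boolP ((b <= i) && (c <= j))) => [/andP[bi cj]|h].
  rewrite (disj bi cj); case: (tab U _ _) => [u|] /=; split.
  - by right.
  - by case=> [[]|[]].
  - by [].
  - by case=> [[]|[]].
rewrite /=; case: ifP => hk; split.
- by move=> [<-]; left.
- by case=> [[_ ->]//|[bi cj]]; move: h; rewrite bi cj.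
- by [].
- by case=> [[]//|[bi cj]]; move: h; rewrite bi cj.
Qed.

Lemma nrows_lt A i j : straight A -> ((i, j) : box) \in A -> i < nrows A.
Proof.
move=> /straightP sA h; rewrite /nrows -[i.+1](size_iota 0).
apply: uniq_leq_size (iota_uniq 0 i.+1) _ => k; rewrite mem_iota => hk.
by apply/imfsetP; exists ((k, j) : box) => //=; apply: sA h; lia.
Qed.

Lemma ncols_lt A i j : straight A -> ((i, j) : box) \in A -> j < ncols A.
Proof.
move=> /straightP sA h; rewrite /ncols -[j.+1](size_iota 0).
apply: uniq_leq_size (iota_uniq 0 j.+1) _ => k; rewrite mem_iota => hk.
by apply/imfsetP; exists ((i, k) : box) => //=; apply: sA h; lia.
Qed.

Lemma fits_dims a b c d U i j u : fits_in_corner a b c d U -> tab U i j = Some u ->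
  i < d /\ j < a - c.
Proof.
move=> [_ sU hr hc _] E; have h : ((i, j) : box) \in domf U by rewrite tab_dom E.
by have := nrows_lt sU h; have := ncols_lt sU h; lia.
Qed.

Lemma fits_values a b c d U i j k l u : c <= a -> fits_in_corner a b c d U ->
  hook a b c d i j -> tab U k l = Some u -> ((i + j + 1)%N%:Z < u)%R.
Proof.
move=> ca [_ _ _ _ H] hk /tab_ex[x _ <-].
have : tab (minimal_tableau (fat_hook a b c d)) i j = Some ((i + j + 1)%N%:Z)%R.
  by rewrite tab_minimal mem_fat_hook // hk.
by move=> /tab_ex[y _ <-]; apply: H.
Qed.

Lemma straight_skew A : straight A -> skew_shape A.
Proof.
move=> sA; exists A, fset0; split; [by []| |exact: fsub0set|by rewrite fsetD0].
by move=> x y _; rewrite inE.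
Qed.

Lemma attach_straight a b c d U : c <= a -> fits_in_corner a b c d U ->
  straight (domf (attach a b c d U)).
Proof.
move=> ca fit; have [_ sU _ _ _] := fit.
apply/straightP => i j k l ik jl; rewrite !tab_dom.
case E: (tab _ k l) => [w|] // _.
suff [v ->] : exists v, tab (attach a b c d U) i j = Some v by [].
have [hk|hk] := boolP (hook a b c d i j).
  by exists ((i + j + 1)%N%:Z)%R; apply/tab_attach => //; left.
move: E; rewrite tab_attach // => -[[hk1 _]|[bk cl E]].
  by exfalso; move: hk hk1; rewrite /hook; lia.
have [kd la] := fits_dims fit E.
have [bi cj] : b <= i /\ c <= j by move: hk; rewrite /hook; lia.
have [u Eu] := straight_tab sU (leq_sub2r b ik) (leq_sub2r c jl) E.
by exists u; apply/tab_attach => //; right.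
Qed.

Lemma attach_increasing a b c d U : c <= a -> fits_in_corner a b c d U ->
  increasing (attach a b c d U).
Proof.
move=> ca fit; have [[_ /increasingP incU] sU _ _ _] := fit.
apply/increasingP => i j k l u v ik jl ne; rewrite !tab_attach //.
case=> [[h1 ->]|[bi cj E]] [[h2 ->]|[bk cl E1]].
- suff : (i + j < k + l)%N by lia.
  by rewrite ltnNge; apply/negP => h; apply: ne; congr pair; lia.
- exact: fits_values ca fit h1 E1.
- by exfalso; move: h2; rewrite /hook; lia.
- apply: incU E E1; [lia|lia|by case=> *; apply: ne; congr pair; lia].
Qed.

(* A small value in box (b, c) is excluded by the chains of v - c, ..., v if v
   does not occur in the first b rows of the minimal tableau, by the
   transposed chains of v - b, ..., v if it does not occur in its first c
   columns, and by the 0-Hecke operators otherwise: they move the particles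
   from all sites <= v - c to the block v - b + 1, ..., v + 1 for V only. *)
Lemma corner_value_large a b c d T U V v : c <= a ->
  fits_in_corner a b c d U -> increasing T ->
  slides T (attach a b c d U) -> slides T V -> straight (domf V) ->
  (forall i j w, tab V i j = Some w -> i < b + d /\ j < a) ->
  (forall i j, hook a b c d i j -> tab V i j = Some ((i + j + 1)%N%:Z)%R) ->
  (forall i j w, hook a b c d 0 0 -> tab V i j = Some w -> (1 <= w)%R) ->
  tab V b c = Some v ->
  exists k l u, tab U k l = Some u /\ (u <= v)%R.
Proof.
move=> ca fit incT TN TV sV dims hookV ge1 E; apply: contrapT => small.
have {}small k l u : tab U k l = Some u -> (v < u)%R.
  by move=> Eu; rewrite ltNge; apply/negP => uv; apply: small; exists k, l, u.
set N := attach a b c d U in TN.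
have incV := slides_increasing TV incT; have incN := slides_increasing TN incT.
have Nle i j w : (w <= v)%R -> tab N i j = Some w ->
    hook a b c d i j /\ w = ((i + j + 1)%N%:Z)%R.
  move=> wv; rewrite /N tab_attach // => -[//|[_ _ /small]]; lia.
have [k [l /(Nle _ _ _ (lexx v))[hkl Ev]]] := slides_value TN TV E.
have h00 : hook a b c d 0 0 by move: hkl; rewrite /hook; lia.
have bcv := straight_ge sV incV (fun i j w => ge1 i j w h00) E.
have Vle i j w : (w <= v)%R -> tab V i j = Some w ->
    (hook a b c d i j /\ w = ((i + j + 1)%N%:Z)%R) \/ [/\ i = b, j = c & w = v].
  move=> wv Ew; have [hk|hk] := boolP (hook a b c d i j).
    by left; split => //; move: Ew; rewrite hookV // => -[].
  have [di dj] := dims _ _ _ Ew.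
  have [bi cj] : b <= i /\ c <= j by move: hk; rewrite /hook; lia.
  have [[E1 E2]|ne] := pselect ((b, c) = (i, j)).
    by right; subst i j; split => //; move: Ew; rewrite E => -[].
  move/increasingP: incV => H; have := H _ _ _ _ _ _ bi cj ne E Ew; lia.
pose vn := (k + l + 1)%N; have Evn : v = (vn%:Z)%R by [].
case: (boolP ((0 < b) && (vn < a + b))) => [P|nP]; last first.
  have [bk [kd lc]] : b <= k /\ k < b + d /\ l < c by move: hkl nP; rewrite /hook; lia.
  have : chain (row_has V) (v - c%:Z)%R c.+1 c.+1 0.
    (* Row [v - c - 1] of the left arm holds [v - c, ..., v - 1], and box [(b, c)] holds [v]. In [N]
       such a chain puts [v] in a column [>= c], hence in the first [b] rows, where it does not
       occur. *)
    apply: (chain_intro (rw := fun r => if r < c then (vn - c).-1 else b)) => r rc.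
      case: ltnP => h; last by exists c; rewrite E; congr Some; lia.
      by exists r; rewrite hookV /hook; [congr Some|]; lia.
    by case: ltnP => h1; case: ltnP => h2; lia.
  rewrite -(slides_chain _ _ _ TV) (slides_chain _ _ _ TN).
  move=> /(chain_top incN)[k1 [c1 [_ cc1 E1 _]]].
  have e : (v - c%:Z + c%:Z = v)%R by lia.
  rewrite e in E1; have [h1 E2] := Nle _ _ _ (lexx v) E1.
  by move: h1 nP; rewrite /hook; lia.
case: (boolP ((0 < c) && (vn < b + c + d))) => [Q|nQ]; last first.
  have [kb la] : k < b /\ l < a by move: hkl nQ; rewrite /hook; lia.
  have : chain (row_has (tr V)) (v - b%:Z)%R b.+1 b.+1 0.
    (* Transposed: column [v - b - 1] of the upper arm, followed by the corner box. *)
    apply: (chain_intro (rw := fun r => if r < b then (vn - b).-1 else c)) => r rb.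
      case: ltnP => h; last by exists b; rewrite tab_tr E; congr Some; lia.
      by exists r; rewrite tab_tr hookV /hook; [congr Some|]; lia.
    by case: ltnP => h1; case: ltnP => h2; lia.
  rewrite -(slides_chain _ _ _ (slides_tr TV)) (slides_chain _ _ _ (slides_tr TN)).
  move=> /(chain_top (increasing_tr incN))[k1 [c1 [_ cc1 E1 _]]].
  have e : (v - b%:Z + b%:Z = v)%R by lia.
  rewrite e tab_tr in E1; have [h1 E2] := Nle _ _ _ (lexx v) E1.
  by move: h1 nQ; rewrite /hook; lia.
have [n1 W1] := slides_word 1%R vn TN; have [n2 W2] := slides_word 1%R vn TV.
(* Large enough for both word identities and for the bounds [b <= n] and [v - c <= n]. *)
pose n := (n1 + n2 + vn)%N.
have := W2 n ltac:(lia); rewrite W1; last lia.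
set fN := row_word (row_has N) _ _; set fV := row_word (row_has V) _ _ => EW.
have memN i z : z \in fN i -> [/\ (z <= v)%R, hook a b c d i `|(z - i%:Z - 1)%R|%N & (i%:Z + 1 <= z)%R].
  rewrite mem_letters => /and3P[h1 h2 /asboolP[j Ej]].
  have [|hk Ez] := Nle i j z _ Ej; first lia.
  split; [lia| |lia]; suff -> : `|(z - i%:Z - 1)%R|%N = j by []; lia.
apply: (block_not_full (f := fN) (b := b) (c := c) (v := vn) (n := n)).
- by move=> r; apply: sorted_letters.
- by move=> i z /memN[].
- by move=> i z bi /memN[_ + h]; rewrite /hook; lia.
- by lia.
- by lia.
rewrite EW; apply: block_full.
- by move=> r; apply: sorted_letters.
- move=> i z; rewrite mem_letters => /and3P[h1 h2 /asboolP[j Ej]].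
  by have [|[hk Ez]|[-> _ ->]] := Vle i j z _ Ej; lia.
- move=> i z ib hz; rewrite mem_letters; apply/and3P; split; [lia|lia|].
  apply/asboolP; exists `|(z - i%:Z - 1)%R|%N; rewrite hookV /hook; [congr Some|]; lia.
- by lia.
- by lia.
- move=> z hz; rewrite mem_letters; apply/and3P; split; [lia|lia|].
  by apply/asboolP; exists `|(z - vn%:Z + c%:Z)%R|%N; rewrite hookV /hook; [congr Some|]; lia.
- rewrite mem_letters; apply/and3P; split; [lia|lia|].
  by apply/asboolP; exists c; rewrite E Evn.
- move=> i hi; apply/negP; rewrite mem_letters => /and3P[_ _ /asboolP[j Ej]].
  have [|[hk Ez]|[Eb _ _]] := Vle i j (vn%:Z)%R _ Ej; [lia| |lia].
  by move: hk; rewrite /hook; lia.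
Qed.

Theorem theorem6p9 (a b c d : nat) (hac : c <= a) (U : {fmap box -> int})
    (hU : unique_rectification_target U) (hfit : fits_in_corner a b c d U) :
  unique_rectification_target (attach a b c d U).
Proof.
have sN := attach_straight hac hfit; have incN := attach_increasing hac hfit.
split => //; first by split => //; apply: straight_skew.
move=> T [[nu [la sp]] incT] [TN _] V [TV sV].
set N := attach a b c d U in sN incN TN *.
have incV := slides_increasing TV incT.
have [[_ incU] sU _ _ _] := hfit.
have dimN i j w : tab N i j = Some w -> i < b + d /\ j < a.
  rewrite /N tab_attach // => -[[+ _]|[bi cj /(fits_dims hfit)]]; last lia.
  by rewrite /hook; lia.
have dimV i j w : tab V i j = Some w -> i < b + d /\ j < a.
  move=> E; split; last by apply: (slides_cols TN TV incT sV _ E) => k l u /dimN[].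
  have := slides_cols (slides_tr TN) (slides_tr TV) (increasing_tr incT).
  rewrite dom_tr => /(_ (b + d)%N (straight_flip sV)) H.
  apply: (H _ j i w); last by rewrite tab_tr.
  by move=> k l u; rewrite tab_tr => /dimN[].
(* The hook must be nonempty here: otherwise nothing bounds the values of [U] from below. *)
have geN i j w : hook a b c d 0 0 -> tab N i j = Some w -> (1 <= w)%R.
  move=> h0; rewrite /N tab_attach // => -[[_ ->]|[_ _ E]]; first lia.
  by have := fits_values hac hfit h0 E; lia.
have geV i j w : hook a b c d 0 0 -> tab V i j = Some w -> (1 <= w)%R.
  by move=> h0 E; have [k [l]] := slides_value TN TV E; apply: geN.
have hookN i j : hook a b c d i j -> tab N i j = Some ((i + j + 1)%N%:Z)%R.
  by move=> h; apply/tab_attach => //; left.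
have hookV i j : hook a b c d i j -> tab V i j = Some ((i + j + 1)%N%:Z)%R.
  move=> h; have h0 : hook a b c d 0 0 by move: h; rewrite /hook; lia.
  (* The upper arm is forced by the width [a]; the boxes outside it lie in the first [c] columns,
     which are forced by the height [b + d] after transposition. *)
  case: (boolP ((i < b) && (j < a))) => [/andP[ib ja]|nh].
    apply: (minimal_block (a := a) (b := b)) => // [k l u|k l u /dimV[]//|t tb].
      exact: geV.
    rewrite -(slides_chain _ _ _ TV) (slides_chain _ _ _ TN).
    apply: (chain_intro (rw := fun=> t)) => // r ra; exists r.
    by rewrite hookN /hook; [congr Some|]; lia.
  have [ib jc] : i < b + d /\ j < c by move: h nh; rewrite /hook; lia.
  have -> : (i + j + 1 = j + i + 1)%N by lia.
  rewrite -tab_tr; apply: (minimal_block (a := (b + d)%N) (b := c)) => //.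
  - by rewrite dom_tr; apply: straight_flip.
  - exact: increasing_tr.
  - by move=> k l u; rewrite tab_tr; apply: geV.
  - by move=> k l u; rewrite tab_tr => /dimV[].
  - move=> t tc; rewrite -(slides_chain _ _ _ (slides_tr TV)) (slides_chain _ _ _ (slides_tr TN)).
    apply: (chain_intro (rw := fun=> t)) => // r rb; exists r.
    by rewrite tab_tr hookN /hook; [congr Some|]; lia.
have corner i j w : tab V i j = Some w -> ~~ hook a b c d i j -> b <= i /\ c <= j.
  by move=> /dimV; rewrite /hook; lia.
have large i j w : b <= i -> c <= j -> tab V i j = Some w ->
    exists2 u, tab U 0 0 = Some u & (u <= w)%R.
  move=> bi cj E; have [v Ev] := straight_tab sV bi cj E.
  have [k [l [u [Eu uv]]]] := corner_value_large hac hfit incT TN TV sV dimV hookV geV Ev.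
  have [u0 Eu0] := straight_tab sU (leq0n k) (leq0n l) Eu.
  exists u0 => //.
  have le1 : (u0 <= u)%R.
    have [[E1 E2]|ne] := pselect ((0, 0) = (k, l)).
      by subst k l; move: Eu; rewrite Eu0 => -[->].
    by move/increasingP: incU => H; have := H _ _ _ _ _ _ (leq0n k) (leq0n l) ne Eu0 Eu; lia.
  have le2 : (v <= w)%R.
    have [[E1 E2]|ne] := pselect ((b, c) = (i, j)).
      by subst i j; move: E; rewrite Ev => -[->].
    by move/increasingP: incV => H; have := H _ _ _ _ _ _ bi cj ne Ev E; lia.
  lia.
have eqNV : (forall i j, b <= i -> c <= j -> tab V i j = tab U (i - b) (j - c)) -> V = N.
  move=> H; apply: tab_inj => i j; have [h|h] := boolP (hook a b c d i j).
    by rewrite hookV // hookN.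
  case E: (tab V i j) => [w|].
    have [bi cj] := corner _ _ _ E h.
    by apply/esym/tab_attach => //; right; split => //; rewrite -H.
  case E1: (tab N i j) => [w|] //; move: E1; rewrite /N tab_attach // => -[[]|[bi cj]].
    by rewrite (negbTE h).
  by rewrite -H // E.
(* If [U] is empty, [large] leaves no entry for the corner of [V]. *)
apply: eqNV; case E0: (tab U 0 0) => [u0|]; last first.
  move=> i j bi cj; case E: (tab V i j) => [w|].
    by have [u] := large _ _ _ bi cj E; rewrite E0.
  case E1: (tab U _ _) => [w|] //.
  by have [u] := straight_tab sU (leq0n _) (leq0n _) E1; rewrite E0.
(* [u0] is the least value of [U] and exceeds all values of the hook, so cutting at [m] isolates the
   corner of [N]; by [large] it also isolates the corner of [V]. *)
pose m := (u0 - 1)%R.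
pose V1 := make (rect d (a - c) (fun _ _ => true)) (fun i j => tab V (b + i)%N (c + j)%N).
have tabV1 i j : tab V1 i j = tab V (b + i)%N (c + j)%N.
  rewrite tab_make mem_rect andbT; case: ifP => // /negbT h.
  by case E: (tab V _ _) => [w|] //; have := dimV _ _ _ E; lia.
have geU i j u : tab U i j = Some u -> (m < u)%R.
  move=> E; have [[E1 E2]|ne] := pselect ((0, 0) = (i, j)).
    by subst i j; move: E; rewrite E0 => -[<-]; lia.
  by move/increasingP: incU => H; have := H _ _ _ _ _ _ (leq0n i) (leq0n j) ne E0 E; lia.
have hook_low i j : hook a b c d i j -> ((i + j + 1)%N%:Z <= m)%R.
  by move=> h; have := fits_values hac hfit h E0; lia.
have aboveN : above m N = translate b c U.
  apply: tab_inj => i j; rewrite tab_translate.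
  case E: (tab (above m N) i j) => [w|].
    have [+ mw] := (tab_above m N i j w).1 E.
    rewrite /N tab_attach // => -[[h Ew]|[-> -> ->]] //.
    by have := hook_low _ _ h; lia.
  case: ifP => // /andP[bi cj]; case E1: (tab U _ _) => [u|] //.
  have : tab (above m N) i j = Some u.
    by apply/tab_above; split; [apply/tab_attach => //; right|apply: geU E1].
  by rewrite E.
have aboveV : above m V = translate b c V1.
  apply: tab_inj => i j; rewrite tab_translate.
  case E: (tab (above m V) i j) => [w|].
    have [Ew mw] := (tab_above m V i j w).1 E.
    have nh : ~~ hook a b c d i j.
      by apply/negP => h; have := hook_low _ _ h; move: Ew; rewrite hookV // => -[Ew]; lia.
    have [bi cj] := corner _ _ _ Ew nh.
    by rewrite bi cj tabV1 !subnKC.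
  case: ifP => // /andP[bi cj]; rewrite tabV1 !subnKC //.
  case E1: (tab V i j) => [w|] //.
  have [u Eu uw] := large _ _ _ bi cj E1.
  have : tab (above m V) i j = Some w.
    by apply/tab_above; split => //; move: Eu; rewrite E0 => -[Eu]; lia.
  by rewrite E.
have sV1 : straight (domf V1).
  apply/straightP => i j k l ik jl; rewrite !tab_dom !tabV1.
  case Ew: (tab V (b + k)%N (c + l)%N) => [w|] // _.
  by have [u ->] := straight_tab sV (leq_add (leqnn b) ik) (leq_add (leqnn c) jl) Ew.
have incV1 : increasing V1.
  apply/increasingP => i j k l u w ik jl ne; rewrite !tabV1.
  move/increasingP: incV => H; apply: H; [lia|lia|].
  by case=> *; apply: ne; congr pair; lia.
have EV1 : V1 = U.
  case: hU => _ _ /(_ (above m T)); apply.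
  - split; last exact: increasing_above.
    by exists nu, (nu `\` domf (above m T)); apply: skew_above sp.
  - split=> //; apply: rt_trans (slides_translate b c sU incU).
    by rewrite -aboveN; apply: slides_above.
  - split=> //; apply: rt_trans (slides_translate b c sV1 incV1).
    by rewrite -aboveV; apply: slides_above.
by move=> i j bi cj; rewrite -EV1 tabV1 !subnKC.
Qed.
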